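(* There is a universal constant $K>0$ such that the following holds. Let $(X,d)$ be the set of leaves of a finite rooted tree with positive edge lengths, equipped with the weighted shortest-path distance, let $n=|X|\ge 2$, and let $D$ be the combinatorial depth of the tree. Then there is a randomized online algorithm for metrical task systems on $(X,d)$ that is $K\, D\log n$-competitive.
   Context: Metrical task systems (MTS) on a finite metric space $(X,d)$: a fixed initial state $\rho_0\in X$ is given, and the input is a finite sequence $\mathbf c=\langle c_1,\dots,c_T\rangle$ of cost functions $c_t:X\to\mathbb R_+$. A randomized online algorithm chooses at each time $t$ a random state $\rho_t\in X$ whose law may depend only on $c_1,\dots,c_t$ (and on internal randomness). Its total cost is $\mathsf{cost}_{\boldsymbol\rho}(\mathbf c)=\sum_{t}\big[c_t(\rho_t)+d(\rho_{t-1},\rho_t)\big]$. The offline optimum $\mathsf{cost}^*(\mathbf c)$ is the infimum of $\sum_t[c_t(\rho_t)+d(\rho_{t-1},\rho_t)]$ over all deterministic sequences of states starting from $\rho_0$. The algorithm is $\alpha$-competitive if for every $\rho_0\in X$ there is a constant $\beta$ such that $\mathbb E[\mathsf{cost}_{\boldsymbol\rho}(\mathbf c)]\le\alpha\,\mathsf{cost}^*(\mathbf c)+\beta$ for all cost sequences $\mathbf c$. The combinatorial depth of a rooted tree is the maximum number of edges on a root-to-leaf path. *)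

(* Defs.v *)
From Stdlib Require Import Reals List Arith Bool.
Import ListNotations.
Open Scope R_scope.

(** * Finite rooted trees with positive edge lengths.
    A tree is given by a number of vertices [N] (vertices are 0..N-1,
    the root is 0), a parent function [par] with [par i < i] for
    1 <= i < N (any finite rooted tree admits such a labelling, e.g. BFS),
    and an edge length [w i] for the edge {i, par i}, 1 <= i < N. *)

Definition tpar (par : nat -> nat) (i : nat) : nat :=
  match i with 0 => 0%nat | _ => par i end.

Definition anc (N : nat) (par : nat -> nat) (a v : nat) : bool :=
  existsb (fun k => Nat.eqb (Nat.iter k (tpar par) v) a) (seq 0 (S N)).

Definition is_tree (N : nat) (par : nat -> nat) (w : nat -> R) : Prop :=
  (1 <= N)%nat /\
  (forall i, (1 <= i < N)%nat -> (par i < i)%nat) /\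
  (forall i, (1 <= i < N)%nat -> 0 < w i).

Definition is_leaf (N : nat) (par : nat -> nat) (v : nat) : bool :=
  Nat.ltb v N && forallb (fun j => negb (Nat.eqb (par j) v)) (seq 1 (N - 1)).

Definition leaves (N : nat) (par : nat -> nat) : list nat :=
  filter (is_leaf N par) (seq 0 N).

(* Weighted path distance in the tree: the (unique, hence shortest) path
   between u and v uses exactly the edges {i, par i} such that i is an
   ancestor-or-self of exactly one of u, v. *)
Definition tdist (N : nat) (par : nat -> nat) (w : nat -> R) (u v : nat) : R :=
  fold_right Rplus 0
    (map (fun i => if xorb (anc N par i u) (anc N par i v) then w i else 0)
         (seq 1 (N - 1))).

Definition vdepth (N : nat) (par : nat -> nat) (v : nat) : nat :=
  length (filter (fun i => anc N par i v) (seq 1 (N - 1))).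

Definition comb_depth (N : nat) (par : nat -> nat) : nat :=
  fold_right Nat.max 0%nat (map (vdepth N par) (seq 0 N)).

Definition sumL (l : list nat) (f : nat -> R) : R :=
  fold_right Rplus 0 (map f l).

(* A randomized online algorithm, in behavioural form: given the cost
   functions revealed so far [c_1;...;c_t] and the states so far
   [rho_0;...;rho_(t-1)], it returns the law of rho_t (a probability
   vector indexed by states). *)
Definition online_alg : Type := list (nat -> R) -> list nat -> nat -> R.

Definition valid_alg (X : list nat) (A : online_alg) : Prop :=
  forall cs hs,
    (forall x, 0 <= A cs hs x) /\
    (forall x, ~ In x X -> A cs hs x = 0) /\
    sumL X (A cs hs) = 1.

Fixpoint exp_cost (X : list nat) (d : nat -> nat -> R) (A : online_alg)
    (past : list (nat -> R)) (hs : list nat) (prev : nat)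
    (cs : list (nat -> R)) : R :=
  match cs with
  | [] => 0
  | c :: cs' =>
      let past' := past ++ [c] in
      sumL X (fun x =>
        A past' hs x *
        (c x + d prev x + exp_cost X d A past' (hs ++ [x]) x cs'))
  end.

Definition alg_cost (X : list nat) (d : nat -> nat -> R) (A : online_alg)
    (rho0 : nat) (cs : list (nat -> R)) : R :=
  exp_cost X d A [] [rho0] rho0 cs.

Fixpoint det_cost (d : nat -> nat -> R) (prev : nat)
    (cs : list (nat -> R)) (rhos : list nat) : R :=
  match cs, rhos with
  | c :: cs', r :: rhos' => c r + d prev r + det_cost d r cs' rhos'
  | _, _ => 0
  end.

(* alpha-competitiveness: for every initial state there is beta such that
   for every nonnegative cost sequence, E[cost] <= alpha * cost^* + beta,
   where cost^* is the infimum of det_cost over all offline sequences of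
   states of the right length; "<= alpha * inf + beta" is expressed as
   "<= alpha * det_cost sigma + beta for every offline sequence sigma". *)
Definition competitive (X : list nat) (d : nat -> nat -> R) (A : online_alg)
    (alpha : R) : Prop :=
  forall rho0, In rho0 X ->
  exists beta : R,
  forall cs : list (nat -> R),
    (forall c x, In c cs -> In x X -> 0 <= c x) ->
    forall sigma : list nat,
      length sigma = length cs -> (forall x, In x sigma -> In x X) ->
      alg_cost X d A rho0 cs <= alpha * det_cost d rho0 cs sigma + beta.

(* Main.v *)
(* Discrete-time mirror descent on the polytope of leaf distributions, with the entropic
   regularizer [sum_u w_u a_u ln a_u], where [a_u = mass_u + delta_u] and [delta_u] is the
   fraction of the leaves that lie below [u].  The optimality conditions of a step from
   [p] to [z] attach a price [lam_u >= 0] to every vertex such that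
   [w_u ln (a_u(z) / a_u(p)) = lam_(par u) - lam_u] and, at a leaf, [lam <= c] with equality
   where [z > 0].  Existence of the prices is shown directly, by solving one scalar
   equation per vertex from the leaves up, instead of through a minimizer.  Comparing with
   an offline state, the service cost plus the total divergence
   [KL = sum_u w_u (a_u(z) ln (a_u(z) / a_u(p)) - a_u(z) + a_u(p))] is at most the offline
   service cost plus the decrease of a potential that is [O(log n)]-Lipschitz in the
   offline state.  Summation by parts against the prices bounds the movement cost by
   [O(depth)] times (service + KL), up to telescoping terms.  The identities are exact, so no
   passage to continuous time or splitting of costs is needed.  Finally an optimal
   transport on the tree, of cost [sum_u w_u |mass_u(p) - mass_u(z)|], turns the sequence
   of distributions into a randomized algorithm. *)

Require Import Defs.
From Stdlib Require Import Reals List Arith Bool.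
From Stdlib Require Import Lra Lia Classical ClassicalEpsilon.
Import ListNotations.
Open Scope R_scope.

(** * Finite sums *)

Definition ind (b : bool) : R := if b then 1 else 0.

Lemma ind_ge0 b : 0 <= ind b.
Proof. destruct b; simpl; lra. Qed.

Lemma sumL_nil f : sumL [] f = 0.
Proof. reflexivity. Qed.

Lemma sumL_cons a l f : sumL (a :: l) f = f a + sumL l f.
Proof. reflexivity. Qed.

Lemma sumL_ext l f g : (forall i, In i l -> f i = g i) -> sumL l f = sumL l g.
Proof.
  induction l as [|a l IH]; intros H; [reflexivity|].
  rewrite !sumL_cons, (H a), IH; auto with datatypes.
Qed.

Lemma sumL_le l f g : (forall i, In i l -> f i <= g i) -> sumL l f <= sumL l g.
Proof.
  induction l as [|a l IH]; intros H; [apply Rle_refl|].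
  rewrite !sumL_cons. apply Rplus_le_compat; auto with datatypes.
Qed.

Lemma sumL_0 l : sumL l (fun _ => 0) = 0.
Proof. induction l as [|a l IH]; [reflexivity|]. rewrite sumL_cons, IH. ring. Qed.

Lemma sumL_ge0 l f : (forall i, In i l -> 0 <= f i) -> 0 <= sumL l f.
Proof. intros H. rewrite <- (sumL_0 l). now apply sumL_le. Qed.

Lemma sumL_plus l f g : sumL l (fun i => f i + g i) = sumL l f + sumL l g.
Proof. induction l as [|a l IH]; [cbn; ring|]. rewrite !sumL_cons, IH. ring. Qed.

Lemma sumL_scal l k f : sumL l (fun i => k * f i) = k * sumL l f.
Proof. induction l as [|a l IH]; [cbn; ring|]. rewrite !sumL_cons, IH. ring. Qed.

Lemma sumL_scalr l k f : sumL l (fun i => f i * k) = sumL l f * k.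
Proof. induction l as [|a l IH]; [cbn; ring|]. rewrite !sumL_cons, IH. ring. Qed.

Lemma sumL_minus l f g : sumL l (fun i => f i - g i) = sumL l f - sumL l g.
Proof. induction l as [|a l IH]; [cbn; ring|]. rewrite !sumL_cons, IH. ring. Qed.

Lemma sumL_const l k : sumL l (fun _ => k) = INR (length l) * k.
Proof.
  induction l as [|a l IH]; [cbn; ring|].
  rewrite sumL_cons, IH. cbn [length]. rewrite S_INR. ring.
Qed.

Lemma sumL_swap l m f :
  sumL l (fun i => sumL m (f i)) = sumL m (fun j => sumL l (fun i => f i j)).
Proof.
  induction l as [|a l IH].
  - symmetry. apply sumL_0.
  - rewrite sumL_cons, IH, <- sumL_plus. reflexivity.
Qed.

Lemma sumL_filter b l f : sumL (filter b l) f = sumL l (fun i => ind (b i) * f i).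
Proof.
  induction l as [|a l IH]; [reflexivity|].
  cbn [filter]. destruct (b a) eqn:E; rewrite !sumL_cons, ?IH, E; cbn [ind]; ring.
Qed.

Lemma sumL_delta l s f :
  NoDup l -> In s l -> sumL l (fun i => ind (Nat.eqb i s) * f i) = f s.
Proof.
  induction l as [|a l IH]; intros Hn Hs; [destruct Hs|].
  rewrite sumL_cons. inversion Hn as [|? ? Ha Hl]; subst.
  destruct (Nat.eqb_spec a s) as [->|Hne].
  - rewrite (sumL_ext l _ (fun _ => 0)), sumL_0.
    + cbn; ring.
    + intros i Hi. destruct (Nat.eqb_spec i s) as [->|]; [contradiction|cbn; ring].
  - destruct Hs as [Hs|Hs]; [contradiction|]. rewrite IH by auto. cbn; ring.
Qed.

Lemma sumL_term_le l s f :
  (forall i, In i l -> 0 <= f i) -> In s l -> f s <= sumL l f.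
Proof.
  induction l as [|a l IH]; intros H Hs; [destruct Hs|].
  rewrite sumL_cons. pose proof (sumL_ge0 l f ltac:(auto with datatypes)).
  destruct Hs as [->|Hs]; [lra|].
  pose proof (H a ltac:(auto with datatypes)).
  specialize (IH ltac:(auto with datatypes) Hs). lra.
Qed.

Lemma length_filter_INR b l : INR (length (filter b l)) = sumL l (fun i => ind (b i)).
Proof.
  induction l as [|a l IH]; [reflexivity|].
  cbn [filter]. rewrite sumL_cons, <- IH.
  destruct (b a); cbn [length ind]; [rewrite S_INR|]; ring.
Qed.

(** Serves as the termination measure for building a transport: the number of leaves still out of
    balance drops strictly. *)
Lemma length_filter_lt (b b' : nat -> bool) l s :
  (forall i, b i = true -> b' i = true) ->
  In s l -> b s = false -> b' s = true ->
  (length (filter b l) < length (filter b' l))%nat.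
Proof.
  intros Hbb'. assert (Hle : forall m, (length (filter b m) <= length (filter b' m))%nat).
  { induction m as [|a m IH]; [reflexivity|]. cbn [filter].
    destruct (b a) eqn:E; [rewrite (Hbb' a E)|destruct (b' a)]; cbn [length]; lia. }
  intros Hs Hb Hb'. induction l as [|a l IH]; [destruct Hs|].
  cbn [filter]. destruct Hs as [->|Hs].
  - rewrite Hb, Hb'. specialize (Hle l). cbn [length]. lia.
  - specialize (IH Hs). destruct (b a) eqn:E; [rewrite (Hbb' a E)|destruct (b' a)];
      cbn [length]; lia.
Qed.

(** * Rooted trees *)

Section Tree.

Variables (N : nat) (par : nat -> nat) (w : nat -> R).
Hypothesis Htree : is_tree N par w.

Definition nonroot : list nat := seq 1 (N - 1).
Definition children (u : nat) : list nat := filter (fun v => Nat.eqb (par v) u) nonroot.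

Lemma nonroot_iff u : In u nonroot <-> (1 <= u < N)%nat.
Proof. unfold nonroot. rewrite in_seq. lia. Qed.

Lemma children_iff u v : In v (children u) <-> (1 <= v < N)%nat /\ par v = u.
Proof. unfold children. now rewrite filter_In, nonroot_iff, Nat.eqb_eq. Qed.

Lemma par_lt u : (1 <= u < N)%nat -> (par u < u)%nat.
Proof. apply Htree. Qed.

Lemma w_gt0 u : In u nonroot -> 0 < w u.
Proof. rewrite nonroot_iff. apply Htree. Qed.

Lemma leaves_iff u : In u (leaves N par) <-> (u < N)%nat /\ children u = [].
Proof.
  unfold leaves. rewrite filter_In, in_seq. unfold is_leaf.
  rewrite andb_true_iff, Nat.ltb_lt, forallb_forall. split.
  - intros (H1 & H2 & H3). split; [exact H2|].
    destruct (children u) as [|v l] eqn:E; [reflexivity|exfalso].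
    assert (Hv : In v (children u)) by (rewrite E; auto with datatypes).
    unfold children in Hv. apply filter_In in Hv as [Hv1 Hv2].
    specialize (H3 v Hv1). now rewrite Hv2 in H3.
  - intros (H1 & H2). repeat split; try lia. intros v Hv.
    destruct (Nat.eqb (par v) u) eqn:E; [exfalso|reflexivity].
    assert (In v (children u)) by (apply filter_In; auto).
    now rewrite H2 in H.
Qed.

Lemma leaves_NoDup : NoDup (leaves N par).
Proof. apply NoDup_filter, seq_NoDup. Qed.

(** Parents have smaller labels and [tpar] fixes the root, so [v] steps are enough to reach it.
    Hence the cut-off at [N] in [anc] loses no ancestor. *)
Lemma iter_tpar_ge v k :
  (v < N)%nat -> (v <= k)%nat -> Nat.iter k (tpar par) v = 0%nat.
Proof.
  revert k. induction v as [v IH] using lt_wf_ind. intros k Hv Hk.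
  assert (H0 : forall j, Nat.iter j (tpar par) 0%nat = 0%nat).
  { induction j as [|j IHj]; [reflexivity|]. rewrite Nat.iter_succ. now rewrite IHj. }
  destruct v as [|v]; [apply H0|]. destruct k as [|k]; [lia|].
  rewrite Nat.iter_succ_r. cbn [tpar].
  pose proof (par_lt (S v) ltac:(lia)). apply IH; lia.
Qed.

Lemma anc_iff a v :
  (v < N)%nat -> anc N par a v = true <-> exists k, Nat.iter k (tpar par) v = a.
Proof.
  intros Hv. unfold anc. rewrite existsb_exists. split.
  - intros (k & _ & E). exists k. now apply Nat.eqb_eq.
  - intros (k & E). destruct (le_lt_dec k N) as [Hk|Hk].
    + exists k. rewrite in_seq, Nat.eqb_eq. split; [lia|exact E].
    + exists N. rewrite in_seq, Nat.eqb_eq. split; [lia|].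
      rewrite <- E, !iter_tpar_ge; lia.
Qed.

Lemma anc_0r a : (0 < N)%nat -> anc N par a 0 = Nat.eqb a 0.
Proof.
  intros HN. apply eq_true_iff_eq. rewrite anc_iff, Nat.eqb_eq by lia. split.
  - intros (k & <-). apply iter_tpar_ge; lia.
  - intros ->. now exists 0%nat.
Qed.

Lemma anc_step a v :
  (1 <= v < N)%nat -> anc N par a v = (Nat.eqb a v || anc N par a (par v))%bool.
Proof.
  intros Hv. pose proof (par_lt v Hv). apply eq_true_iff_eq.
  rewrite orb_true_iff, !anc_iff, Nat.eqb_eq by lia.
  assert (Ht : tpar par v = par v) by (destruct v; [lia|reflexivity]). split.
  - intros ([|k] & E); [now left|right]. exists k. now rewrite Nat.iter_succ_r, Ht in E.
  - intros [->|(k & E)]; [now exists 0%nat|]. exists (S k). now rewrite Nat.iter_succ_r, Ht.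
Qed.

Lemma anc_le a v : (v < N)%nat -> anc N par a v = true -> (a <= v)%nat.
Proof.
  induction v as [v IH] using lt_wf_ind. intros Hv.
  destruct v as [|v].
  - rewrite anc_0r, Nat.eqb_eq by lia. lia.
  - pose proof (par_lt (S v) ltac:(lia)).
    rewrite anc_step, orb_true_iff, Nat.eqb_eq by lia. intros [->|Ha]; [lia|].
    specialize (IH (par (S v)) ltac:(lia) ltac:(lia) Ha). lia.
Qed.

Lemma anc_0l v : (v < N)%nat -> anc N par 0 v = true.
Proof. intros Hv. apply anc_iff; [exact Hv|]. exists v. now apply iter_tpar_ge. Qed.

Lemma anc_refl v : (v < N)%nat -> anc N par v v = true.
Proof. intros Hv. apply anc_iff; [exact Hv|]. now exists 0%nat. Qed.

Lemma anc_trans a b v :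
  (v < N)%nat -> anc N par a b = true -> anc N par b v = true -> anc N par a v = true.
Proof.
  intros Hv Hab Hbv. pose proof (anc_le b v Hv Hbv).
  apply anc_iff in Hab as (j & Ej); [|lia]. apply anc_iff in Hbv as (k & Ek); [|lia].
  apply anc_iff; [exact Hv|]. exists (j + k)%nat. now rewrite Nat.iter_add, Ek.
Qed.

(** The ancestors of one vertex form a chain along which labels grow away from the root, so
    comparing labels tells which of two is higher. *)
Lemma anc_chain a b v :
  (v < N)%nat -> anc N par a v = true -> anc N par b v = true -> (a <= b)%nat ->
  anc N par a b = true.
Proof.
  induction v as [v IH] using lt_wf_ind. intros Hv Ha Hb Hab.
  destruct v as [|v].
  - rewrite anc_0r, Nat.eqb_eq in Ha, Hb by lia. subst. apply anc_refl; lia.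
  - pose proof (par_lt (S v) ltac:(lia)).
    pose proof Ha as Ha0. rewrite anc_step, orb_true_iff, Nat.eqb_eq in Ha, Hb by lia.
    destruct Hb as [->|Hb]; [exact Ha0|]. destruct Ha as [->|Ha].
    + apply anc_le in Hb; lia.
    + apply (IH (par (S v))); auto; lia.
Qed.

(** Written with indicators, this also says that at most one child of [u] lies above [l], which is
    what makes masses additive. *)
Lemma anc_children u l :
  (u < N)%nat -> (l < N)%nat ->
  ind (anc N par u l) =
    ind (Nat.eqb u l) + sumL (children u) (fun v => ind (anc N par v l)).
Proof.
  intros Hu. induction l as [l IH] using lt_wf_ind. intros Hl.
  destruct (Nat.eq_dec l 0) as [->|Hl0].
  - rewrite anc_0r, (sumL_ext _ _ (fun _ => 0)), sumL_0 by
      (try intros v Hv%children_iff; try rewrite anc_0r; try (destruct v); cbn; lia || reflexivity).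
    ring.
  - pose proof (par_lt l ltac:(lia)) as Hp.
    (* Going from [par l] to [l] adds only [l] itself to the ancestors, and [l] is a child of [u]
       exactly when [par l = u]. *)
    rewrite (sumL_ext _ _ (fun v => ind (Nat.eqb v l) * 1 + ind (anc N par v (par l)))).
    2:{ intros v Hv. rewrite anc_step by lia. destruct (Nat.eqb_spec v l) as [->|]; cbn [orb].
        - destruct (anc N par l (par l)) eqn:E; [apply anc_le in E; lia|cbn; ring].
        - cbn; ring. }
    rewrite sumL_plus. specialize (IH (par l) Hp ltac:(lia)).
    unfold children at 1. rewrite sumL_filter.
    rewrite (sumL_ext _ _ (fun v => ind (Nat.eqb v l) * ind (Nat.eqb (par l) u))).
    2:{ intros v _. destruct (Nat.eqb_spec v l) as [->|]; cbn; ring. }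
    rewrite sumL_delta by (apply seq_NoDup || (apply nonroot_iff; lia)).
    rewrite anc_step by lia.
    replace (Nat.eqb (par l) u) with (Nat.eqb u (par l)) by apply Nat.eqb_sym.
    destruct (Nat.eqb_spec u l) as [->|]; cbn [orb].
    + destruct (anc N par l (par l)) eqn:E; [apply anc_le in E; lia|]. cbn [ind] in *. lra.
    + cbn [ind] in *. lra.
Qed.

Lemma sum_by_parent (F G : nat -> R) :
  sumL nonroot (fun u => F (par u) * G u) =
  sumL (seq 0 N) (fun p => F p * sumL (children p) G).
Proof.
  transitivity (sumL (seq 0 N) (fun p => sumL nonroot (fun u =>
    F p * (ind (Nat.eqb (par u) p) * G u)))).
  - rewrite <- (sumL_swap nonroot). apply sumL_ext. intros u Hu.
    apply nonroot_iff in Hu. pose proof (par_lt u Hu).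
    rewrite (sumL_ext _ _ (fun p => ind (Nat.eqb p (par u)) * (F p * G u))).
    + rewrite sumL_delta by (apply seq_NoDup || (apply in_seq; lia)). reflexivity.
    + intros p _. rewrite (Nat.eqb_sym p). ring.
  - apply sumL_ext. intros p _. rewrite sumL_scal. unfold children. now rewrite sumL_filter.
Qed.

Lemma sum_vertices F : (0 < N)%nat -> sumL (seq 0 N) F = F 0%nat + sumL nonroot F.
Proof.
  intros HN. unfold nonroot. destruct N as [|n]; [lia|].
  cbn [seq]. rewrite Nat.sub_succ, Nat.sub_0_r. apply sumL_cons.
Qed.

Lemma sum_leaves F :
  sumL (leaves N par) F = sumL (seq 0 N) (fun u => ind (is_leaf N par u) * F u).
Proof. apply sumL_filter. Qed.

Lemma is_leaf_iff u : (u < N)%nat -> is_leaf N par u = true <-> children u = [].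
Proof.
  intros Hu. pose proof (leaves_iff u) as H. unfold leaves in H. rewrite filter_In, in_seq in H.
  destruct H as [H1 H2]. split; intros E.
  - apply H1. split; [lia|exact E].
  - now apply H2.
Qed.

(** * Mass of a leaf distribution below a vertex *)

Definition mass (p : nat -> R) (u : nat) : R :=
  sumL (leaves N par) (fun l => ind (anc N par u l) * p l).

Lemma N_gt0 : (0 < N)%nat.
Proof. destruct Htree; lia. Qed.

Lemma leaf_lt l : In l (leaves N par) -> (l < N)%nat.
Proof. rewrite leaves_iff. tauto. Qed.

Lemma mass_children p u :
  (u < N)%nat -> children u <> [] -> mass p u = sumL (children u) (mass p).
Proof.
  intros Hu Hc. unfold mass. rewrite <- sumL_swap. apply sumL_ext. intros l Hl.
  apply leaves_iff in Hl as [Hl Hl'].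
  rewrite sumL_scalr, (anc_children u l Hu Hl). f_equal.
  destruct (Nat.eqb_spec u l) as [->|]; [contradiction|]. cbn; ring.
Qed.

Lemma anc_of_leaf u l :
  In u (leaves N par) -> In l (leaves N par) -> anc N par u l = Nat.eqb l u.
Proof.
  intros [Hu Hc]%leaves_iff Hl%leaf_lt.
  pose proof (anc_children u l Hu Hl) as H. rewrite Hc, sumL_nil, Rplus_0_r in H.
  rewrite Nat.eqb_sym. destruct (anc N par u l), (Nat.eqb u l); cbn in H; auto; lra.
Qed.

Lemma mass_leaf p l : In l (leaves N par) -> mass p l = p l.
Proof.
  intros Hl. unfold mass. rewrite <- (sumL_delta (leaves N par) l p leaves_NoDup Hl).
  apply sumL_ext. intros i Hi. now rewrite anc_of_leaf.
Qed.

Lemma mass_root p : mass p 0 = sumL (leaves N par) p.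
Proof.
  apply sumL_ext. intros l Hl%leaf_lt. rewrite anc_0l by exact Hl. cbn; ring.
Qed.

Lemma mass_ge_leaf p u l :
  (forall i, 0 <= p i) -> In l (leaves N par) -> anc N par u l = true -> p l <= mass p u.
Proof.
  intros Hp Hl Ha. replace (p l) with (ind (anc N par u l) * p l) by (rewrite Ha; cbn; ring).
  apply (sumL_term_le _ l (fun l => ind (anc N par u l) * p l)); [|exact Hl].
  intros i _. apply Rmult_le_pos; [apply ind_ge0|apply Hp].
Qed.

Lemma mass_ge0 p u : (forall i, 0 <= p i) -> 0 <= mass p u.
Proof.
  intros Hp. apply sumL_ge0. intros i _. apply Rmult_le_pos; [apply ind_ge0|apply Hp].
Qed.

Lemma mass_le_total p u : (forall i, 0 <= p i) -> mass p u <= sumL (leaves N par) p.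
Proof.
  intros Hp. apply sumL_le. intros i _. specialize (Hp i).
  destruct (anc N par u i); cbn [ind]; lra.
Qed.

Lemma leaf_below u : (u < N)%nat -> exists l, In l (leaves N par) /\ anc N par u l = true.
Proof.
  intros Hu. remember (N - u)%nat as k eqn:Ek. revert u Hu Ek.
  induction k as [k IH] using lt_wf_ind. intros u Hu ->.
  destruct (children u) as [|v c] eqn:E.
  - exists u. split; [now apply leaves_iff|now apply anc_refl].
  - assert (Hv : In v (children u)) by (rewrite E; auto with datatypes).
    apply children_iff in Hv as [Hv Hp]. pose proof (par_lt v Hv).
    destruct (IH (N - v)%nat ltac:(lia) v ltac:(lia) eq_refl) as (l & Hl & Ha).
    exists l. split; [exact Hl|]. apply (anc_trans u v); auto using leaf_lt.
    rewrite anc_step, Hp, (anc_refl u) by lia. apply orb_true_r.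
Qed.

(** * Summation by parts for additive functions, plain and weighted by depth *)

Definition additive (h : nat -> R) : Prop :=
  forall u, (u < N)%nat -> children u <> [] -> h u = sumL (children u) h.

(** Regrouping the edges by their upper endpoint, the coefficient of [F] at an inner vertex other
    than the root is the mass of the children minus its own, which is zero. Only the root and the
    leaves remain. *)
Lemma sum_difference h F :
  additive h ->
  sumL nonroot (fun u => h u * (F (par u) - F u)) =
  h 0%nat * F 0%nat - sumL (leaves N par) (fun l => h l * F l).
Proof.
  intros Hh.
  rewrite (sumL_ext _ _ (fun u => F (par u) * h u - h u * F u)) by (intros; ring).
  rewrite sumL_minus, sum_by_parent.
  pose proof (sum_vertices (fun u => h u * F u) N_gt0) as HV. cbv beta in HV.
  replace (sumL nonroot (fun u => h u * F u)) with
    (sumL (seq 0 N) (fun u => h u * F u) - h 0%nat * F 0%nat) by (rewrite HV; ring).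
  rewrite sum_leaves.
  enough (sumL (seq 0 N) (fun u => h u * F u) =
    sumL (seq 0 N) (fun p => F p * sumL (children p) h)
    + sumL (seq 0 N) (fun u => ind (is_leaf N par u) * (h u * F u))) by lra.
  rewrite <- sumL_plus. apply sumL_ext. intros u Hu. apply in_seq in Hu.
  pose proof (is_leaf_iff u ltac:(lia)) as HL. destruct (is_leaf N par u); cbn [ind].
  - rewrite (proj1 HL eq_refl), sumL_nil. ring.
  - rewrite <- (Hh u); [ring|lia|]. intros E. apply HL in E. discriminate.
Qed.

Definition depth (v : nat) : R := INR (vdepth N par v).

Lemma depth_ge0 v : 0 <= depth v.
Proof. apply pos_INR. Qed.

Lemma depth_sum v : depth v = sumL nonroot (fun i => ind (anc N par i v)).
Proof. apply length_filter_INR. Qed.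

Lemma depth_root : depth 0 = 0.
Proof.
  rewrite depth_sum, (sumL_ext _ _ (fun _ => 0)); [apply sumL_0|].
  intros i Hi%nonroot_iff. rewrite anc_0r by lia. destruct i; [lia|reflexivity].
Qed.

Lemma depth_par v : In v nonroot -> depth v = 1 + depth (par v).
Proof.
  intros Hv. pose proof Hv as Hv'. apply nonroot_iff in Hv'. pose proof (par_lt v Hv').
  rewrite !depth_sum.
  rewrite (sumL_ext _ _ (fun i => ind (Nat.eqb i v) * 1 + ind (anc N par i (par v)))).
  - rewrite sumL_plus, sumL_delta; [reflexivity|apply seq_NoDup|exact Hv].
  - intros i Hi. rewrite anc_step by lia. destruct (Nat.eqb_spec i v) as [->|]; cbn [orb].
    + destruct (anc N par v (par v)) eqn:E; [apply anc_le in E; lia|cbn; ring].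
    + cbn; ring.
Qed.

Lemma vdepth_le v : (v < N)%nat -> (vdepth N par v <= comb_depth N par)%nat.
Proof.
  intros Hv. unfold comb_depth.
  assert (H : In (vdepth N par v) (map (vdepth N par) (seq 0 N)))
    by (apply in_map, in_seq; lia).
  induction (map (vdepth N par) (seq 0 N)) as [|a l IH]; [destruct H|].
  cbn [fold_right]. destruct H as [->|H]; [lia|]. specialize (IH H). lia.
Qed.

Lemma depth_le v : (v < N)%nat -> depth v <= INR (comb_depth N par).
Proof. intros Hv. now apply le_INR, vdepth_le. Qed.

(** This is [sum_difference] for [(1 + depth u) * F u]: one edge down raises the depth by one, so
    each difference splits off exactly one copy of [F u]. It trades a sum of prices for
    depth-weighted price differences. *)
Lemma sum_depth_difference h F :
  additive h ->
  sumL nonroot (fun u => h u * F u) =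
    sumL nonroot (fun u => depth u * (h u * (F (par u) - F u)))
    + sumL (leaves N par) (fun l => (1 + depth l) * (h l * F l)) - h 0%nat * F 0%nat.
Proof.
  intros Hh.
  pose proof (sum_difference h (fun u => (1 + depth u) * F u) Hh) as H1. cbv beta in H1.
  rewrite depth_root in H1.
  rewrite (sumL_ext nonroot (fun u => h u * ((1 + depth (par u)) * F (par u) - (1 + depth u) * F u))
    (fun u => depth u * (h u * (F (par u) - F u)) - h u * F u)) in H1.
  2:{ intros u Hu. rewrite (depth_par u Hu). ring. }
  rewrite sumL_minus in H1.
  rewrite (sumL_ext (leaves N par) _ (fun l => (1 + depth l) * (h l * F l))) in H1
    by (intros; ring).
  lra.
Qed.

(** * Optimal transport on the tree *)

(** The same three clauses as in [valid_alg], so any kernel row that is a distribution is a legal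
    answer of an online algorithm. *)
Definition is_dist (p : nat -> R) : Prop :=
  (forall x, 0 <= p x) /\ (forall x, ~ In x (leaves N par) -> p x = 0) /\
  sumL (leaves N par) p = 1.

Definition point (s t : nat) : R := ind (Nat.eqb t s).

Lemma point_dist s : In s (leaves N par) -> is_dist (point s).
Proof.
  intros Hs. repeat split.
  - intros x. apply ind_ge0.
  - intros x Hx. unfold point. destruct (Nat.eqb_spec x s) as [->|]; [contradiction|reflexivity].
  - rewrite (sumL_ext _ _ (fun t => ind (Nat.eqb t s) * 1)) by (intros; unfold point; ring).
    now apply sumL_delta; [apply leaves_NoDup|].
Qed.

Lemma tdist_sum u v :
  tdist N par w u v =
  sumL nonroot (fun i => if xorb (anc N par i u) (anc N par i v) then w i else 0).
Proof. reflexivity. Qed.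

Lemma tdist_ge0 u v : 0 <= tdist N par w u v.
Proof.
  apply (sumL_ge0 nonroot). intros i Hi. pose proof (w_gt0 i Hi).
  destruct (xorb _ _); lra.
Qed.

Lemma tdist_refl u : tdist N par w u u = 0.
Proof.
  rewrite !tdist_sum.
  rewrite (sumL_ext _ _ (fun _ => 0)); [apply sumL_0|]. intros i _. now rewrite xorb_nilpotent.
Qed.

Lemma tdist_triangle u v x : tdist N par w u x <= tdist N par w u v + tdist N par w v x.
Proof.
  rewrite !tdist_sum.
  rewrite <- sumL_plus. apply sumL_le. intros i Hi. pose proof (w_gt0 i Hi).
  destruct (anc N par i u), (anc N par i v), (anc N par i x); cbn; lra.
Qed.

(** The earth mover distance for a tree metric: each edge carries the net mass that has to cross
    it. *)
Definition movement (p z : nat -> R) : R :=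
  sumL nonroot (fun u => w u * Rabs (mass p u - mass z u)).

(** Every row is a distribution, even at an [s] that is no leaf, because [valid_alg] quantifies over
    arbitrary histories. *)
Definition transports (p z : nat -> R) (T : nat -> nat -> R) (C : R) : Prop :=
  (forall s, is_dist (T s)) /\
  (forall t, In t (leaves N par) -> sumL (leaves N par) (fun s => p s * T s t) = z t) /\
  sumL (leaves N par) (fun s => p s * sumL (leaves N par) (fun t => T s t * tdist N par w s t)) <= C.

Lemma sumL_point s f :
  In s (leaves N par) -> sumL (leaves N par) (fun t => point s t * f t) = f s.
Proof. intros Hs. apply sumL_delta; [apply leaves_NoDup|exact Hs]. Qed.

(** The kernels are composed through the middle state [r]; the costs add up by the triangle
    inequality, the first using that the rows of [T2] sum to one, the second the marginal of
    [T1]. *)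
Lemma transports_comp p q z T1 T2 C1 C2 :
  (forall s, 0 <= p s) -> transports p q T1 C1 -> transports q z T2 C2 ->
  transports p z
    (fun s t => sumL (leaves N par) (fun r => T1 s r * T2 r t)) (C1 + C2).
Proof.
  intros Hp (D1 & M1 & K1) (D2 & M2 & K2). repeat split.
  - intros t. apply sumL_ge0. intros r _. apply Rmult_le_pos; [apply D1|apply D2].
  - intros t Ht. rewrite (sumL_ext _ _ (fun _ => 0)); [apply sumL_0|].
    intros r _. rewrite (proj1 (proj2 (D2 r)) t Ht). ring.
  - rewrite sumL_swap. rewrite (sumL_ext _ _ (T1 s)); [apply D1|].
    intros r _. rewrite sumL_scal. rewrite (proj2 (proj2 (D2 r))). ring.
  - intros t Ht. rewrite <- (M2 t Ht).
    rewrite (sumL_ext (leaves N par) (fun s => p s * _) (fun s => sumL (leaves N par) (fun r => p s * (T1 s r * T2 r t))))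
      by (intros; now rewrite sumL_scal).
    rewrite sumL_swap. apply sumL_ext. intros r Hr. rewrite <- (M1 r Hr), <- sumL_scalr.
    apply sumL_ext. intros; ring.
  - eapply Rle_trans; [|apply (Rplus_le_compat _ _ _ _ K1 K2)].
    apply (Rle_trans _ (sumL (leaves N par) (fun s => sumL (leaves N par) (fun r => p s * T1 s r *
      sumL (leaves N par) (fun t => T2 r t * (tdist N par w s r + tdist N par w r t)))))).
    + apply sumL_le. intros s _.
      rewrite (sumL_ext (leaves N par) (fun r => p s * T1 s r * _) (fun r => p s * (sumL (leaves N par) (fun t =>
        T1 s r * (T2 r t * (tdist N par w s r + tdist N par w r t))))))
        by (intros; rewrite sumL_scal; ring).
      rewrite sumL_scal, sumL_swap. apply Rmult_le_compat_l; [apply Hp|].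
      apply sumL_le. intros t _. rewrite <- sumL_scalr. apply sumL_le. intros r _.
      rewrite Rmult_assoc. apply Rmult_le_compat_l; [apply D1|].
      apply Rmult_le_compat_l; [apply D2|apply tdist_triangle].
    + rewrite (sumL_ext (leaves N par) _ (fun s => sumL (leaves N par) (fun r => p s * (T1 s r * tdist N par w s r))
        + sumL (leaves N par) (fun r => p s * T1 s r * sumL (leaves N par) (fun t => T2 r t * tdist N par w r t)))).
      2:{ intros s _. rewrite <- sumL_plus. apply sumL_ext. intros r _.
          rewrite (sumL_ext (leaves N par) _ (fun t => T2 r t * tdist N par w s r + T2 r t * tdist N par w r t))
            by (intros; ring).
          rewrite sumL_plus, sumL_scalr, (proj2 (proj2 (D2 r))). ring. }
      rewrite sumL_plus. apply Rplus_le_compat.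
      * right. apply sumL_ext. intros s _. now rewrite sumL_scal.
      * rewrite sumL_swap. right. apply sumL_ext. intros r Hr.
        now rewrite sumL_scalr, (M1 r Hr).
Qed.

(** With [choice] this gives a retraction of all labels onto the leaves, so that kernels and start
    states are defined everywhere. *)
Lemma leaf_default s : exists s0, In s0 (leaves N par) /\ (In s (leaves N par) -> s0 = s).
Proof.
  destruct (in_dec Nat.eq_dec s (leaves N par)) as [Hs|Hs].
  - now exists s.
  - destruct (leaf_below 0 N_gt0) as (l & Hl & _). exists l. now split.
Qed.

Lemma transports_refl p z :
  (forall s, In s (leaves N par) -> p s = z s) -> exists T, transports p z T 0.
Proof.
  intros Hpz.
  destruct (choice (fun s s0 => In s0 (leaves N par) /\ (In s (leaves N par) -> s0 = s)) leaf_default) as (f & Hf).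
  exists (fun s => point (f s)). split; [|split].
  - intros s. apply point_dist, Hf.
  - intros t Ht. rewrite (sumL_ext _ _ (fun s => ind (Nat.eqb s t) * p s)).
    + rewrite sumL_delta by (apply leaves_NoDup || exact Ht). auto.
    + intros s Hs. rewrite (proj2 (Hf s) Hs). unfold point. rewrite Nat.eqb_sym. ring.
  - right. rewrite (sumL_ext _ _ (fun _ => 0)); [apply sumL_0|].
    intros s Hs. rewrite (proj2 (Hf s) Hs), sumL_point, tdist_refl by exact Hs. ring.
Qed.

Lemma transports_move p s t e :
  In s (leaves N par) -> In t (leaves N par) -> 0 < e <= p s ->
  exists T, transports p (fun r => p r - e * point s r + e * point t r) T
    (e * tdist N par w s t).
Proof.
  intros Hs Ht He.
  destruct (choice (fun s s0 => In s0 (leaves N par) /\ (In s (leaves N par) -> s0 = s)) leaf_default) as (f & Hf).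
  set (k := e / p s).
  assert (Hk : 0 <= k <= 1).
  { unfold k. split; [apply Rmult_le_pos; [lra|left; apply Rinv_0_lt_compat; lra]|].
    apply (Rmult_le_reg_r (p s)); [lra|]. unfold Rdiv. rewrite Rmult_assoc, Rinv_l by lra. lra. }
  assert (Hke : p s * k = e) by (unfold k; field; lra).
  (* Every leaf stays put, except that [s] jumps to [t] with probability [k = e / p s]. *)
  set (T := fun r q => point (f r) q + ind (Nat.eqb r s) * k * (point t q - point s q)).
  exists T.
  assert (HT : forall g r, sumL (leaves N par) (fun q => T r q * g q) =
    g (f r) + ind (Nat.eqb r s) * k * (g t - g s)).
  { intros g r. unfold T.
    rewrite (sumL_ext _ _ (fun q => point (f r) q * g q
      + ind (Nat.eqb r s) * k * (point t q * g q - point s q * g q))) by (intros; ring).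
    rewrite sumL_plus, sumL_scal, sumL_minus, !sumL_point by (auto; apply Hf). reflexivity. }
  split; [|split].
  - intros r. repeat split.
    + intros q. unfold T. destruct (Nat.eqb_spec r s) as [->|]; cbn [ind].
      * rewrite (proj2 (Hf s) Hs). unfold point.
        destruct (Nat.eqb q s), (Nat.eqb q t); cbn [ind]; lra.
      * pose proof (ind_ge0 (Nat.eqb q (f r))). unfold point. lra.
    + intros q Hq. unfold T, point.
      destruct (Nat.eqb_spec q (f r)) as [->|]; [destruct Hq; apply Hf|].
      destruct (Nat.eqb_spec q t) as [->|]; [contradiction|].
      destruct (Nat.eqb_spec q s) as [->|]; [contradiction|]. cbn; ring.
    + pose proof (HT (fun _ => 1) r) as H. cbv beta in H.
      rewrite (sumL_ext _ _ (T r)) in H by (intros; ring). rewrite H. ring.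
  - intros q Hq. unfold T.
    rewrite (sumL_ext _ _ (fun r => point q r * p r
       + point s r * (p r * k * (point t q - point s q)))).
    + rewrite sumL_plus, !sumL_point by assumption. rewrite Hke. ring.
    + intros r Hr. rewrite (proj2 (Hf r) Hr). unfold point.
      rewrite (Nat.eqb_sym q r). ring.
  - right. rewrite (sumL_ext _ _ (fun r => point s r * (p r * k * tdist N par w r t))).
    + rewrite sumL_point, Hke by assumption. reflexivity.
    + intros r Hr. rewrite HT, (proj2 (Hf r) Hr), tdist_refl. unfold point.
      destruct (Nat.eqb_spec r s) as [->|]; cbn [ind]; rewrite ?tdist_refl; ring.
Qed.

Lemma exists_max_index (P : nat -> Prop) n :
  (exists u, (u < n)%nat /\ P u) ->
  exists u, (u < n)%nat /\ P u /\ forall v, (v < n)%nat -> P v -> (v <= u)%nat.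
Proof.
  induction n as [|n IH]; intros (u & Hu & HP); [lia|].
  destruct (classic (P n)) as [Hn|Hn].
  - exists n. repeat split; auto. intros; lia.
  - destruct IH as (q & Hq & HPq & Hmax).
    + exists u. split; [|exact HP]. assert (u <> n) by (intros ->; contradiction). lia.
    + exists q. repeat split; auto. intros v Hv HPv. apply Hmax; [|exact HPv].
      assert (v <> n) by (intros ->; contradiction). lia.
Qed.

Lemma exists_lt_of_sum (X : list nat) p z :
  sumL X p = sumL X z -> (exists r, In r X /\ p r <> z r) -> exists r, In r X /\ p r < z r.
Proof.
  intros Hsum (r & Hr & Hne). apply NNPP. intros Hno.
  assert (Hge : forall i, In i X -> 0 <= p i - z i).
  { intros i Hi. apply Rge_le, Rge_minus, Rnot_lt_ge. intros Hlt. apply Hno. now exists i. }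
  pose proof (sumL_term_le X r (fun i => p i - z i) Hge Hr) as H. cbv beta in H.
  rewrite sumL_minus in H. pose proof (Hge r Hr). lra.
Qed.

Lemma mass_minus p z u : mass (fun r => p r - z r) u = mass p u - mass z u.
Proof. unfold mass. rewrite <- sumL_minus. apply sumL_ext. intros; ring. Qed.

Lemma mass_point s u : In s (leaves N par) -> mass (point s) u = ind (anc N par u s).
Proof.
  intros Hs. unfold mass. rewrite <- (sumL_point s (fun l => ind (anc N par u l)) Hs).
  apply sumL_ext. intros; ring.
Qed.

(* The deepest vertex having both surplus and deficit leaves below it: every edge
   on the path from a surplus leaf [s] to a deficit leaf [t] below that vertex sees a
   pure surplus or a pure deficit, hence moving mass from [s] to [t] wastes nothing. *)
Lemma surplus_deficit_pair p z :
  sumL (leaves N par) p = sumL (leaves N par) z ->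
  (exists r, In r (leaves N par) /\ p r <> z r) ->
  exists s t, In s (leaves N par) /\ In t (leaves N par) /\ z s < p s /\ p t < z t /\
    forall u, In u nonroot ->
      (anc N par u s = true -> anc N par u t = false -> p s - z s <= mass p u - mass z u) /\
      (anc N par u s = false -> anc N par u t = true -> z t - p t <= mass z u - mass p u).
Proof.
  intros Hsum Hne.
  set (surplus := fun u s => In s (leaves N par) /\ anc N par u s = true /\ z s < p s).
  set (deficit := fun u t => In t (leaves N par) /\ anc N par u t = true /\ p t < z t).
  (* Labels grow away from the root, so the largest label stands in for the deepest vertex. The root
     is a candidate because the totals agree and the distributions differ. *)
  destruct (exists_max_index (fun u => (exists s, surplus u s) /\ exists t, deficit u t) N)
    as (q & Hq & ((s & Hs & Hqs & Hzp) & (t & Ht & Hqt & Hpz)) & Hmax).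
  { exists 0%nat. split; [apply N_gt0|]. split.
    - destruct (exists_lt_of_sum (leaves N par) z p) as (r & Hr & Hlt).
      + now symmetry.
      + destruct Hne as (r & Hr & H). exists r. auto.
      + exists r. unfold surplus. auto using anc_0l, leaf_lt.
    - destruct (exists_lt_of_sum (leaves N par) p z Hsum Hne) as (r & Hr & Hlt).
      exists r. unfold deficit. auto using anc_0l, leaf_lt. }
  exists s, t. do 4 (split; [assumption|]). intros u Hu%nonroot_iff.
  (* A vertex above [a] but not above [b] lies strictly below [q]: otherwise, by the chain property,
     it would be above [q] and hence above [b]. *)
  assert (Hbelow : forall a b, In a (leaves N par) -> In b (leaves N par) ->
    anc N par q a = true -> anc N par q b = true ->
    anc N par u a = true -> anc N par u b = false -> (q < u)%nat).
  { intros a b Ha Hb Hqa Hqb Hua Hub. apply Nat.nle_gt. intros Hle.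
    assert (anc N par u b = true); [|congruence].
    apply (anc_trans u q b); auto using leaf_lt. apply (anc_chain u q a); auto using leaf_lt. }
  split; intros Hus Hut.
  - pose proof (Hbelow s t Hs Ht Hqs Hqt Hus Hut) as Hqu.
    rewrite <- mass_minus. unfold mass.
    replace (p s - z s) with (ind (anc N par u s) * (p s - z s)) by (rewrite Hus; cbn; ring).
    apply (sumL_term_le _ s (fun l => ind (anc N par u l) * (p l - z l))); [|exact Hs].
    intros l Hl. destruct (anc N par u l) eqn:E; cbn [ind]; [|lra].
    (* A deficit leaf here would make [u] a candidate with a larger label than [q]. *)
    destruct (Rlt_le_dec (p l) (z l)) as [Hlt|]; [exfalso|lra].
    enough (u <= q)%nat by lia. apply Hmax; [lia|]. unfold surplus, deficit. eauto 8.
  - pose proof (Hbelow t s Ht Hs Hqt Hqs Hut Hus) as Hqu.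
    rewrite <- mass_minus. unfold mass.
    replace (z t - p t) with (ind (anc N par u t) * (z t - p t)) by (rewrite Hut; cbn; ring).
    apply (sumL_term_le _ t (fun l => ind (anc N par u l) * (z l - p l))); [|exact Ht].
    intros l Hl. destruct (anc N par u l) eqn:E; cbn [ind]; [|lra].
    destruct (Rlt_le_dec (z l) (p l)) as [Hlt|]; [exfalso|lra].
    enough (u <= q)%nat by lia. apply Hmax; [lia|]. unfold surplus, deficit. eauto 8.
Qed.

(** Induction on the number of leaves where [p] and [z] differ. Moving mass from the surplus leaf to
    the deficit leaf of [surplus_deficit_pair] lowers [movement] by exactly the cost of the move. *)
Lemma transport_exists p z :
  is_dist p -> is_dist z -> exists T, transports p z T (movement p z).
Proof.
  intros Hp Hz.
  set (differs := fun (p : nat -> R) r => if Req_dec_T (p r) (z r) then false else true).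
  remember (length (filter (differs p) (leaves N par))) as k eqn:Ek.
  revert p Hp Ek. induction k as [k IH] using lt_wf_ind. intros p Hp ->.
  destruct (classic (exists r, In r (leaves N par) /\ p r <> z r)) as [Hne|Heq].
  2:{ destruct (transports_refl p z) as (T & HT).
      { intros s Hs. apply NNPP. intros H. apply Heq. eauto. }
      exists T. destruct HT as (H1 & H2 & H3). split; [exact H1|split; [exact H2|]].
      eapply Rle_trans; [exact H3|]. apply sumL_ge0. intros u Hu.
      apply Rmult_le_pos; [left; now apply w_gt0|apply Rabs_pos]. }
  pose proof Hp as (Hp0 & HpX & Hp1). pose proof Hz as (Hz0 & HzX & Hz1).
  destruct (surplus_deficit_pair p z) as (s & t & Hs & Ht & Hzp & Hpz & Hedge);
    [congruence|exact Hne|].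
  (* The largest amount that overshoots at neither end; it balances [s] or [t] completely, which
     gives the decrease [Hcount]. *)
  set (e := Rmin (p s - z s) (z t - p t)).
  assert (He0 : 0 < e) by (apply Rmin_glb_lt; lra).
  assert (Hes : e <= p s - z s) by apply Rmin_l.
  assert (Het : e <= z t - p t) by apply Rmin_r.
  pose proof (Hz0 s).
  destruct (transports_move p s t e Hs Ht) as (T1 & HT1); [lra|].
  set (p' := fun r => p r - e * point s r + e * point t r) in *.
  assert (Hst : s <> t) by (intros ->; lra).
  assert (Hps : p' s = p s - e).
  { unfold p', point. rewrite Nat.eqb_refl. destruct (Nat.eqb_spec s t); [contradiction|]. cbn; ring. }
  assert (Hpt : p' t = p t + e).
  { unfold p', point. rewrite Nat.eqb_refl. destruct (Nat.eqb_spec t s); [congruence|]. cbn; ring. }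
  assert (Hpo : forall r, r <> s -> r <> t -> p' r = p r).
  { intros r H1 H2. unfold p', point. destruct (Nat.eqb_spec r s), (Nat.eqb_spec r t);
      try contradiction. cbn; ring. }
  assert (Hp' : is_dist p').
  { repeat split.
    - intros x. destruct (Nat.eq_dec x s) as [->|]; [rewrite Hps; lra|].
      destruct (Nat.eq_dec x t) as [->|]; [rewrite Hpt; specialize (Hp0 t); lra|].
      now rewrite Hpo.
    - intros x Hx. rewrite Hpo; [auto|intros ->; contradiction|intros ->; contradiction].
    - unfold p'. rewrite sumL_plus, sumL_minus, !sumL_scal.
      rewrite (proj2 (proj2 (point_dist s Hs))), (proj2 (proj2 (point_dist t Ht))). lra. }
  assert (Hcount : (length (filter (differs p') (leaves N par))
                    < length (filter (differs p) (leaves N par)))%nat).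
  { assert (Hsub : forall i, differs p' i = true -> differs p i = true).
    { intros i. unfold differs. destruct (Req_dec_T (p i) (z i)) as [E|]; [|reflexivity].
      destruct (Req_dec_T (p' i) (z i)) as [|E']; [discriminate|]. intros _. exfalso.
      apply E'. rewrite <- E. apply Hpo; intros ->; lra. }
    assert (Hcase : e = p s - z s \/ e = z t - p t).
    { unfold e, Rmin. destruct (Rle_dec _ _); auto. }
    destruct Hcase as [E|E].
    - apply (length_filter_lt _ _ _ s Hsub Hs); unfold differs.
      + destruct (Req_dec_T (p' s) (z s)); [reflexivity|lra].
      + destruct (Req_dec_T (p s) (z s)); [lra|reflexivity].
    - apply (length_filter_lt _ _ _ t Hsub Ht); unfold differs.
      + destruct (Req_dec_T (p' t) (z t)); [reflexivity|lra].
      + destruct (Req_dec_T (p t) (z t)); [lra|reflexivity]. }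
  destruct (IH _ Hcount p' Hp' eq_refl) as (T2 & HT2).
  exists (fun a b => sumL (leaves N par) (fun r => T1 a r * T2 r b)).
  replace (movement p z) with (e * tdist N par w s t + movement p' z);
    [now apply (transports_comp p p' z)|].
  unfold movement. rewrite tdist_sum.
  rewrite <- sumL_scal, <- sumL_plus. apply sumL_ext. intros u Hu.
  assert (Hm : mass p' u = mass p u - e * ind (anc N par u s) + e * ind (anc N par u t)).
  { rewrite <- (mass_point s u Hs), <- (mass_point t u Ht). unfold mass, p'.
    rewrite <- !sumL_scal, <- sumL_minus, <- sumL_plus. apply sumL_ext. intros; ring. }
  rewrite Hm. destruct (Hedge u Hu) as [H1 H2].
  destruct (anc N par u s), (anc N par u t); cbn [xorb ind].
  - rewrite Rmult_0_r, Rplus_0_l. f_equal. f_equal. ring.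
  - specialize (H1 eq_refl eq_refl). rewrite !Rabs_pos_eq by lra. ring.
  - specialize (H2 eq_refl eq_refl). rewrite !Rabs_left1 by lra. ring.
  - rewrite Rmult_0_r, Rplus_0_l. f_equal. f_equal. ring.
Qed.

(** * The mirror descent step *)

(* [f] gives the price at a vertex as a function of the price at its parent. *)
Definition price_map (C : R) (f : R -> R) : Prop :=
  (forall p q, p <= q -> f p <= f q /\ p - f p <= q - f q) /\
  (forall p, Rmin p 0 <= f p <= Rmax p C).

(** Since [f p] and [p - f p] are both nondecreasing, [f] is 1-Lipschitz. *)
Lemma price_map_continuous C f : price_map C f -> continuity f.
Proof.
  intros [Hf _] x eps Heps. exists eps. split; [exact Heps|]. intros y [_ Hy].
  cbn in *. unfold Rdist in *. destruct (Rle_dec x y) as [Hxy|Hxy].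
  - destruct (Hf x y Hxy). rewrite Rabs_pos_eq in * by lra. lra.
  - destruct (Hf y x ltac:(lra)). rewrite Rabs_left1 in * by lra. lra.
Qed.

(** The total smoothed mass of the children [ch] after the step if their parent has price [x], where
    [b] is the smoothed mass before the step. *)
Definition response (b : nat -> R) (f : nat -> R -> R) (ch : list nat) (x : R) : R :=
  sumL ch (fun v => b v * exp ((x - f v x) / w v)).

Lemma exp_le x y : x <= y -> exp x <= exp y.
Proof. intros [H| ->]; [left; now apply exp_increasing|apply Rle_refl]. Qed.

Lemma ln_le x y : 0 < x -> x <= y -> ln x <= ln y.
Proof. intros Hx [H| ->]; [left; now apply ln_increasing|apply Rle_refl]. Qed.

Lemma div_le_div a b k : 0 < k -> a <= b -> a / k <= b / k.
Proof. intros Hk H. apply Rmult_le_compat_r; [left; now apply Rinv_0_lt_compat|exact H]. Qed.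

Lemma div_le0 a k : 0 < k -> a <= 0 -> a / k <= 0.
Proof. intros Hk H. pose proof (div_le_div a 0 k Hk H). unfold Rdiv in *. lra. Qed.

Lemma div_ge0 a k : 0 < k -> 0 <= a -> 0 <= a / k.
Proof. intros Hk H. pose proof (div_le_div 0 a k Hk H). unfold Rdiv in *. lra. Qed.

Lemma response_continuous C b f ch :
  (forall v, In v ch -> price_map C (f v)) -> continuity (response b f ch).
Proof.
  unfold response. induction ch as [|a ch IH]; intros H.
  - apply continuity_const. now intros x y.
  - apply (continuity_plus (fun x => b a * exp ((x - f a x) / w a))
      (fun x => sumL ch (fun v => b v * exp ((x - f v x) / w v)))).
    + apply (continuity_scal (fun x => exp ((x - f a x) / w a))).
      apply (continuity_comp (fun x => (x - f a x) / w a) exp).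
      * apply (continuity_mult (fun x => x - f a x) (fun _ => / w a)).
        -- apply (continuity_minus (fun x => x) (f a)).
           ++ apply derivable_continuous, derivable_id.
           ++ apply (price_map_continuous C). auto with datatypes.
        -- apply continuity_const. now intros x y.
      * apply derivable_continuous, derivable_exp.
    + apply IH. auto with datatypes.
Qed.

(** For [x <= 0] the children have prices at least [x] and gain nothing; for [x >= C] their prices
    are at most [x] and they lose nothing. These are the sign conditions for the intermediate value
    theorem. *)
Lemma response_facts C b f ch :
  (forall v, In v ch -> 0 < b v /\ 0 < w v /\ price_map C (f v)) ->
  (forall x y, x <= y -> response b f ch x <= response b f ch y) /\
  (forall x, x <= 0 -> response b f ch x <= sumL ch b) /\
  (forall x, C <= x -> sumL ch b <= response b f ch x).
Proof.
  intros H. unfold response. repeat split; intros x;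
    [intros y Hxy|intros Hx|intros Hx]; apply sumL_le; intros v Hv;
    destruct (H v Hv) as (Hb & Hw & Hf1 & Hf2).
  - apply Rmult_le_compat_l; [lra|]. apply exp_le, div_le_div; [exact Hw|now apply Hf1].
  - specialize (Hf2 x). rewrite Rmin_left in Hf2 by exact Hx.
    pose proof (exp_le _ 0 (div_le0 (x - f v x) (w v) Hw ltac:(lra))).
    rewrite exp_0 in *. rewrite <- (Rmult_1_r (b v)) at 2. apply Rmult_le_compat_l; lra.
  - specialize (Hf2 x). rewrite Rmax_left in Hf2 by exact Hx.
    pose proof (exp_le 0 _ (div_ge0 (x - f v x) (w v) Hw ltac:(lra))).
    rewrite exp_0 in *. rewrite <- (Rmult_1_r (b v)) at 1. apply Rmult_le_compat_l; lra.
Qed.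

(** No edge enters the root, so its price is fixed by conservation of the total mass. *)
Lemma root_price C b f ch :
  0 <= C -> (forall v, In v ch -> 0 < b v /\ 0 < w v /\ price_map C (f v)) ->
  exists x, 0 <= x <= C /\ response b f ch x = sumL ch b.
Proof.
  intros HC H. destruct (response_facts C b f ch H) as (_ & H0 & H1).
  specialize (H0 0 (Rle_refl _)). specialize (H1 C (Rle_refl _)).
  destruct (IVT_cor (fun x => response b f ch x - sumL ch b) 0 C) as (x & Hx & E).
  - apply (continuity_minus (response b f ch) (fun _ => sumL ch b)).
    + apply (response_continuous C). intros v Hv. now apply H.
    + apply continuity_const. now intros x y.
  - exact HC.
  - pose proof (Rmult_le_pos (sumL ch b - response b f ch 0)
      (response b f ch C - sumL ch b) ltac:(lra) ltac:(lra)). lra.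
  - exists x. split; [exact Hx|lra].
Qed.

(** The price must make the mass dictated by the edge above, decreasing in the price, equal to the
    response of the children, nondecreasing in it. The solution is again a price map, so the
    construction can continue upwards. *)
Lemma inner_price C b f ch k :
  0 <= C -> 0 < k -> (forall v, In v ch -> 0 < b v /\ 0 < w v /\ price_map C (f v)) ->
  0 < sumL ch b ->
  exists g, price_map C g /\
    forall p, sumL ch b * exp ((p - g p) / k) = response b f ch (g p).
Proof.
  intros HC Hk H HB. destruct (response_facts C b f ch H) as (Hmono & H0 & H1).
  set (B := sumL ch b) in *.
  assert (Hsol : forall p, exists x, Rmin p 0 <= x <= Rmax p C /\
    B * exp ((p - x) / k) = response b f ch x).
  { intros p. pose proof (Rmin_l p 0). pose proof (Rmin_r p 0).
    pose proof (Rmax_l p C). pose proof (Rmax_r p C).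
    destruct (IVT_cor (fun x => response b f ch x - B * exp ((p - x) / k))
      (Rmin p 0) (Rmax p C)) as (x & Hx & E).
    - apply (continuity_minus (response b f ch) (fun x => B * exp ((p - x) / k))).
      + apply (response_continuous C). intros v Hv. now apply H.
      + apply (continuity_scal (fun x => exp ((p - x) / k))).
        apply (continuity_comp (fun x => (p - x) / k) exp);
          [|apply derivable_continuous, derivable_exp].
        apply (continuity_mult (fun x => p - x) (fun _ => / k)).
        * apply (continuity_minus (fun _ => p) (fun x => x)).
          -- apply continuity_const. now intros x y.
          -- apply derivable_continuous, derivable_id.
        * apply continuity_const. now intros x y.
    - lra.
    - specialize (H0 (Rmin p 0) ltac:(lra)). specialize (H1 (Rmax p C) ltac:(lra)).
      pose proof (exp_le 0 _ (div_ge0 (p - Rmin p 0) k Hk ltac:(lra))) as E0.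
      pose proof (exp_le _ 0 (div_le0 (p - Rmax p C) k Hk ltac:(lra))) as E1.
      rewrite exp_0 in E0, E1.
      pose proof (Rmult_le_compat_l B _ _ ltac:(lra) E0).
      pose proof (Rmult_le_compat_l B _ _ ltac:(lra) E1).
      pose proof (Rmult_le_pos
        (B * exp ((p - Rmin p 0) / k) - response b f ch (Rmin p 0))
        (response b f ch (Rmax p C) - B * exp ((p - Rmax p C) / k))
        ltac:(lra) ltac:(lra)). lra.
    - exists x. split; [exact Hx|lra]. }
  destruct (choice _ Hsol) as (g & Hg). exists g. split; [split|].
  - intros p q Hpq. destruct (Hg p) as [_ Ep]. destruct (Hg q) as [_ Eq].
    assert (Hexp : forall x y, B * exp (x / k) <= B * exp (y / k) -> x <= y).
    { intros x y Hxy. apply Rnot_lt_le. intros Hlt.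
      apply (Rmult_le_reg_l B) in Hxy; [|exact HB].
      pose proof (exp_increasing (y / k) (x / k)
        (Rmult_lt_compat_r (/ k) y x (Rinv_0_lt_compat k Hk) Hlt)). lra. }
    (* If [g] decreased, the monotone response would force [q - g q <= p - g p], which contradicts
       [p <= q]. *)
    assert (Hgpq : g p <= g q).
    { apply Rnot_lt_le. intros Hlt. pose proof (Hmono (g q) (g p) ltac:(lra)) as Hm.
      rewrite <- Ep, <- Eq in Hm. apply Hexp in Hm. lra. }
    split; [exact Hgpq|]. apply Hexp. rewrite Ep, Eq. now apply Hmono.
  - intros p. apply Hg.
  - intros p. apply Hg.
Qed.

(** A leaf has its cost as price, unless this exceeds the parent's price by more than [cap]; then
    the price stops at that level. *)
Lemma leaf_price C c cap :
  0 <= c <= C -> 0 <= cap -> price_map C (fun p => Rmin c (p + cap)).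
Proof.
  intros Hc Hcap. split.
  - intros p q Hpq. unfold Rmin. destruct (Rle_dec c _), (Rle_dec c _); lra.
  - intros p. unfold Rmin, Rmax. destruct (Rle_dec p 0), (Rle_dec c _), (Rle_dec p C); lra.
Qed.

(** Built from the largest label down: children have larger labels than their parent, so their maps
    are known when the parent's is chosen. *)
Lemma price_maps_exist C (b c cap : nat -> R) :
  0 <= C -> (forall u, In u nonroot -> 0 < b u) -> additive b ->
  (forall u, In u (leaves N par) -> 0 <= c u <= C /\ 0 <= cap u) ->
  exists f, forall u, In u nonroot ->
    price_map C (f u) /\
    (children u = [] -> forall p, f u p = Rmin (c u) (p + cap u)) /\
    (children u <> [] -> forall p,
      b u * exp ((p - f u p) / w u) = response b f (children u) (f u p)).
Proof.
  intros HC Hb Hadd Hc.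
  enough (Hk : forall k, exists f, forall u, In u nonroot -> (N - k <= u)%nat ->
    price_map C (f u) /\
    (children u = [] -> forall p, f u p = Rmin (c u) (p + cap u)) /\
    (children u <> [] -> forall p,
      b u * exp ((p - f u p) / w u) = response b f (children u) (f u p))).
  { destruct (Hk N) as (f & Hf). exists f. intros u Hu. apply Hf; [exact Hu|lia]. }
  induction k as [|k (f & IH)].
  - exists (fun _ x => x). intros u Hu%nonroot_iff ?. lia.
  - destruct (classic (In (N - S k)%nat nonroot /\ (k < N)%nat)) as [[Hq HkN]|Hq].
    2:{ exists f. intros u Hu Hle. apply IH; [exact Hu|].
        enough (u <> (N - S k)%nat) by lia. intros ->. apply Hq. split; [exact Hu|].
        apply nonroot_iff in Hu. lia. }
    set (q := (N - S k)%nat) in *.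
    assert (Hchild : forall u v, (q <= u)%nat -> In v (children u) ->
      In v nonroot /\ (N - k <= v)%nat).
    { intros u v Hu [Hv Hp]%children_iff. rewrite nonroot_iff. pose proof (par_lt v Hv). lia. }
    assert (Hg : exists g, price_map C g /\
      (children q = [] -> forall p, g p = Rmin (c q) (p + cap q)) /\
      (children q <> [] -> forall p,
        b q * exp ((p - g p) / w q) = response b f (children q) (g p))).
    { pose proof Hq as Hq'. apply nonroot_iff in Hq'.
      destruct (classic (children q = [])) as [E|E].
      - exists (fun p => Rmin (c q) (p + cap q)).
        destruct (Hc q) as [Hcq Hcap]; [apply leaves_iff; split; [lia|exact E]|].
        split; [now apply leaf_price|]. split; [reflexivity|]. contradiction.
      - destruct (inner_price C b f (children q) (w q)) as (g & Hg1 & Hg2).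
        + exact HC.
        + now apply w_gt0.
        + intros v Hv. destruct (Hchild q v (Nat.le_refl _) Hv) as [Hv1 Hv2].
          split; [now apply Hb|]. split; [now apply w_gt0|]. now apply IH.
        + rewrite <- Hadd; [now apply Hb|lia|exact E].
        + exists g. split; [exact Hg1|]. split; [contradiction|]. intros _ p.
          rewrite <- Hg2, <- Hadd; [reflexivity|lia|exact E]. }
    destruct Hg as (g & Hg).
    exists (fun u => if Nat.eqb u q then g else f u). intros u Hu Hle.
    (* Redefining the map at [q] leaves these responses alone, since children of a vertex [u >= q]
       have labels above [q]. *)
    assert (Hresp : forall x, response b (fun v => if Nat.eqb v q then g else f v) (children u) x
      = response b f (children u) x).
    { intros x. apply sumL_ext. intros v Hv.
      destruct (Hchild u v Hle Hv). destruct (Nat.eqb_spec v q); [lia|reflexivity]. }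
    destruct (Nat.eqb_spec u q) as [->|Hne].
    + destruct Hg as (Hg1 & Hg2 & Hg3). split; [exact Hg1|]. split; [exact Hg2|].
      intros E p. now rewrite Hresp, Hg3.
    + destruct (IH u Hu ltac:(lia)) as (H1 & H2 & H3). split; [exact H1|].
      split; [exact H2|]. intros E p. now rewrite Hresp, H3.
Qed.

(** The downward pass: solve for the root price, then evaluate the price maps along the edges.
    Nonnegativity is inherited from the parent through the lower bound [Rmin p 0]. *)
Lemma prices_exist C (b c cap : nat -> R) :
  0 <= C -> (forall u, In u nonroot -> 0 < b u) -> additive b ->
  (forall u, In u (leaves N par) -> 0 <= c u <= C /\ 0 <= cap u) ->
  exists lam : nat -> R,
    (forall u, (u < N)%nat -> 0 <= lam u) /\
    (forall u, In u nonroot -> children u = [] ->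
       lam u = Rmin (c u) (lam (par u) + cap u)) /\
    (forall u, In u nonroot -> children u <> [] ->
       b u * exp ((lam (par u) - lam u) / w u) =
       sumL (children u) (fun v => b v * exp ((lam u - lam v) / w v))) /\
    sumL (children 0) b = sumL (children 0) (fun v => b v * exp ((lam 0%nat - lam v) / w v)).
Proof.
  intros HC Hb Hadd Hc.
  destruct (price_maps_exist C b c cap HC Hb Hadd Hc) as (f & Hf).
  assert (Hch : forall u v, In v (children u) -> In v nonroot).
  { intros u v [Hv _]%children_iff. now apply nonroot_iff. }
  destruct (root_price C b f (children 0) HC) as (x0 & Hx0 & E0).
  { intros v Hv%Hch. split; [now apply Hb|]. split; [now apply w_gt0|]. now apply Hf. }
  assert (Hlam : exists lam : nat -> R, lam 0%nat = x0 /\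
    forall u, In u nonroot -> lam u = f u (lam (par u))).
  { enough (Hk : forall k, exists lam : nat -> R, lam 0%nat = x0 /\
      forall u, In u nonroot -> (u < k)%nat -> lam u = f u (lam (par u))).
    { destruct (Hk N) as (lam & H1 & H2). exists lam. split; [exact H1|].
      intros u Hu. apply H2; [exact Hu|]. apply nonroot_iff in Hu. lia. }
    induction k as [|k (lam & H1 & H2)].
    - exists (fun _ => x0). split; [reflexivity|]. intros; lia.
    - destruct k as [|k].
      { exists lam. split; [exact H1|]. intros u Hu%nonroot_iff ?. lia. }
      exists (fun u => if Nat.eqb u (S k) then f (S k) (lam (par (S k))) else lam u).
      split; [exact H1|]. intros u Hu Huk.
      pose proof Hu as Hu'. apply nonroot_iff in Hu'. pose proof (par_lt u Hu').
      destruct (Nat.eqb_spec (par u) (S k)); [lia|].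
      destruct (Nat.eqb_spec u (S k)) as [->|]; [reflexivity|]. apply H2; [exact Hu|lia]. }
  destruct Hlam as (lam & Hlam0 & Hlam).
  assert (Hresp : forall u, response b f (children u) (lam u) =
    sumL (children u) (fun v => b v * exp ((lam u - lam v) / w v))).
  { intros u. apply sumL_ext. intros v Hv. rewrite (Hlam v (Hch u v Hv)).
    apply children_iff in Hv as [_ ->]. reflexivity. }
  exists lam. repeat split.
  - induction u as [u IH] using lt_wf_ind. intros Hu.
    destruct (Nat.eq_dec u 0) as [->|Hu0]; [lra|].
    assert (Hu' : In u nonroot) by (apply nonroot_iff; lia).
    pose proof (par_lt u ltac:(lia)). specialize (IH (par u) ltac:(lia) ltac:(lia)).
    rewrite (Hlam u Hu'). destruct (Hf u Hu') as ((_ & Hp) & _).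
    specialize (Hp (lam (par u))). rewrite Rmin_right in Hp by exact IH. lra.
  - intros u Hu E. rewrite (Hlam u Hu) at 1. now apply Hf.
  - intros u Hu E. rewrite <- Hresp. rewrite (Hlam u Hu). now apply Hf.
  - rewrite <- Hresp, Hlam0. now symmetry.
Qed.

Lemma mass_additive p : additive (mass p).
Proof. intros u Hu E. now apply mass_children. Qed.

Lemma additive_plus h g : additive h -> additive g -> additive (fun u => h u + g u).
Proof. intros Hh Hg u Hu E. now rewrite sumL_plus, <- Hh, <- Hg. Qed.

Lemma additive_minus h g : additive h -> additive g -> additive (fun u => h u - g u).
Proof. intros Hh Hg u Hu E. now rewrite sumL_minus, <- Hh, <- Hg. Qed.

(** * Smoothed masses and the mirror descent update *)

Definition nleaves : R := INR (length (leaves N par)).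
(** Encoded as the mass of the uniform distribution, so that additivity comes for free. *)
Definition delta (u : nat) : R := mass (fun _ => / nleaves) u.
Definition smoothed (p : nat -> R) (u : nat) : R := mass p u + delta u.

Lemma nleaves_gt0 : 0 < nleaves.
Proof.
  destruct (leaf_below 0 N_gt0) as (l & Hl & _). unfold nleaves. apply lt_0_INR.
  destruct (leaves N par); [destruct Hl|cbn; lia].
Qed.

Lemma delta_root : delta 0 = 1.
Proof.
  unfold delta. rewrite mass_root, sumL_const. apply Rinv_r.
  pose proof nleaves_gt0. lra.
Qed.

Lemma delta_ge u : (u < N)%nat -> / nleaves <= delta u.
Proof.
  intros Hu. destruct (leaf_below u Hu) as (l & Hl & Ha).
  apply (mass_ge_leaf (fun _ => / nleaves) u l); auto.
  intros _. left. apply Rinv_0_lt_compat, nleaves_gt0.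
Qed.

Lemma delta_gt0 u : (u < N)%nat -> 0 < delta u.
Proof.
  intros Hu. pose proof (delta_ge u Hu).
  pose proof (Rinv_0_lt_compat nleaves nleaves_gt0). lra.
Qed.

Lemma smoothed_gt0 p u : (forall i, 0 <= p i) -> (u < N)%nat -> 0 < smoothed p u.
Proof.
  intros Hp Hu. unfold smoothed. pose proof (mass_ge0 p u Hp).
  pose proof (delta_gt0 u Hu). lra.
Qed.

Lemma smoothed_additive p : additive (smoothed p).
Proof. apply additive_plus; apply mass_additive. Qed.

Lemma children_root : (1 < N)%nat -> children 0 <> [].
Proof.
  intros HN E. assert (In 1%nat (children 0)); [|now rewrite E in H].
  apply children_iff. pose proof (par_lt 1 ltac:(lia)). lia.
Qed.

(** The prices prescribe the new smoothed masses [a]; subtracting [delta] at the leaves gives [z].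
    The last clause is complementary slackness: mass remains only where the price equals the
    cost. *)
Lemma mirror_step p c :
  (1 < N)%nat -> is_dist p -> (forall l, In l (leaves N par) -> 0 <= c l) ->
  exists z lam, is_dist z /\
    (forall u, (u < N)%nat -> 0 <= lam u) /\
    (forall u, In u nonroot ->
      smoothed z u = smoothed p u * exp ((lam (par u) - lam u) / w u)) /\
    (forall l, In l (leaves N par) -> lam l <= c l /\ z l * (c l - lam l) = 0).
Proof.
  intros HN Hp Hc. pose proof Hp as (Hp0 & _ & Hp1).
  set (C := sumL (leaves N par) c).
  (* A leaf whose price exceeds its parent's price by [cap] has lost all its mass. *)
  set (cap := fun u => w u * ln (smoothed p u / delta u)).
  assert (Hleaf : forall l, In l (leaves N par) -> In l nonroot).
  { intros l [Hl E]%leaves_iff. apply nonroot_iff. enough (l <> 0%nat) by lia.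
    intros ->. now apply children_root. }
  assert (Hb : forall u, (u < N)%nat -> 0 < smoothed p u)
    by (intros u; now apply smoothed_gt0).
  destruct (prices_exist C (smoothed p) c cap) as (lam & H0 & Hl & Hi & Hr).
  - apply sumL_ge0. exact Hc.
  - intros u Hu%nonroot_iff. apply Hb. lia.
  - apply smoothed_additive.
  - intros u Hu. split; [split; [now apply Hc|now apply sumL_term_le]|].
    pose proof (delta_gt0 u (leaf_lt u Hu)) as Hd.
    apply Rmult_le_pos; [left; now apply w_gt0, Hleaf|].
    rewrite <- ln_1. apply ln_le; [lra|].
    apply (Rmult_le_reg_r (delta u)); [exact Hd|]. unfold Rdiv.
    rewrite Rmult_assoc, Rinv_l by lra. unfold smoothed. pose proof (mass_ge0 p u Hp0). lra.
  - set (a := fun u => smoothed p u * exp ((lam (par u) - lam u) / w u)).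
    set (z := fun l => if in_dec Nat.eq_dec l (leaves N par) then a l - delta l else 0).
    assert (Hzl : forall l, In l (leaves N par) -> z l = a l - delta l).
    { intros l H. unfold z. destruct (in_dec _ _ _); [reflexivity|contradiction]. }
    (* At leaves this is the definition of [z]; the price equation at inner vertices says that [a]
       is additive, which carries the identity upwards. *)
    assert (Hz : forall u, In u nonroot -> smoothed z u = a u).
    { intros u Hu. remember (N - u)%nat as k eqn:Ek. revert u Hu Ek.
      induction k as [k IH] using lt_wf_ind. intros u Hu ->.
      pose proof Hu as Hu'. apply nonroot_iff in Hu'.
      destruct (classic (children u = [])) as [E|E].
      - unfold smoothed. assert (In u (leaves N par)) by (apply leaves_iff; split; [lia|exact E]).
        rewrite mass_leaf, Hzl by assumption. ring.
      - rewrite (smoothed_additive z u) by (lia || exact E). unfold a. rewrite Hi by assumption.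
        apply sumL_ext. intros v Hv. apply children_iff in Hv as [Hv Hpar].
        pose proof (par_lt v Hv). rewrite (IH (N - v)%nat ltac:(lia) v);
          [|now apply nonroot_iff|reflexivity]. unfold a. now rewrite Hpar. }
    assert (Hcap : forall l, In l (leaves N par) ->
      smoothed p l * exp (- cap l / w l) = delta l).
    { intros l Hl'. pose proof (w_gt0 l (Hleaf l Hl')). pose proof (leaf_lt l Hl').
      pose proof (Hb l ltac:(lia)). pose proof (delta_gt0 l ltac:(lia)).
      unfold cap. replace (- (w l * ln (smoothed p l / delta l)) / w l)
        with (- ln (smoothed p l / delta l)) by (field; lra).
      rewrite exp_Ropp, exp_ln.
      - field. lra.
      - apply Rmult_lt_0_compat; [assumption|now apply Rinv_0_lt_compat]. }
    exists z, lam. split; [|split; [exact H0|split; [exact Hz|]]].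
    + repeat split.
      * intros l. destruct (in_dec Nat.eq_dec l (leaves N par)) as [Hl'|Hl'].
        -- rewrite (Hzl l Hl'). unfold a. rewrite <- (Hcap l Hl').
           pose proof (Hleaf l Hl') as Hnr. pose proof (Hl l Hnr) as El.
           apply leaves_iff in Hl' as [Hl1 Hl2]. specialize (El Hl2).
           pose proof (Rmin_r (c l) (lam (par l) + cap l)).
           assert (- cap l / w l <= (lam (par l) - lam l) / w l)
             by (apply div_le_div; [now apply w_gt0|lra]).
           pose proof (Rmult_le_compat_l (smoothed p l) _ _
             (Rlt_le _ _ (Hb l Hl1)) (exp_le _ _ H1)). lra.
        -- unfold z. destruct (in_dec _ _ _); [contradiction|lra].
      * intros l Hl'. unfold z. destruct (in_dec _ _ _); [contradiction|reflexivity].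
      * rewrite <- mass_root.
        enough (smoothed z 0 = smoothed p 0).
        { unfold smoothed in H. rewrite (mass_root p), Hp1 in H. lra. }
        rewrite (smoothed_additive z 0%nat), (smoothed_additive p 0%nat), Hr
          by (apply N_gt0 || now apply children_root).
        apply sumL_ext. intros v [Hv Hpv]%children_iff.
        rewrite Hz by now apply nonroot_iff. unfold a. now rewrite Hpv.
    + intros l Hl'. pose proof (Hleaf l Hl') as Hnr. pose proof (Hl l Hnr) as El.
      pose proof Hl' as Hl''. apply leaves_iff in Hl'' as [Hl1 Hl2]. specialize (El Hl2).
      split; [rewrite El; apply Rmin_l|].
      (* Either the price is the full cost, or the cap is attained and the smoothed mass is exactly
         [delta l], so [z l = 0]. *)
      unfold Rmin in El. destruct (Rle_dec (c l) (lam (par l) + cap l)) as [_|_].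
      * rewrite El. ring.
      * rewrite (Hzl l Hl'), <- (Hcap l Hl'). unfold a.
        replace (lam (par l) - lam l) with (- cap l) by lra. ring.
Qed.

(** * The potential function *)

Definition D : R := INR (comb_depth N par).

(* [4 D + 5] times the part of the Bregman divergence from [point s] to [p] that varies
   with [p], corrected by the terms that telescope when the movement cost is charged
   to the service cost. *)
Definition potential (s : nat) (p : nat -> R) : R :=
  sumL nonroot (fun u => w u *
    ((4 * D + 5) * (mass p u - (ind (anc N par u s) + delta u) * ln (smoothed p u))
     - (2 * (D + 1) * (mass p u - 2 * delta u * ln (smoothed p u))
        + 2 * (depth u * mass p u) + mass p u))).

Lemma D_ge0 : 0 <= D.
Proof. apply pos_INR. Qed.

(** Up to telescoping terms, movement is at most [2 * A + 2 * KL], [A] is at most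
    [D * KL + (D + 1) * (S + Sd)], and [Sd] equals [S + KL] by [H1] and [H2]. So service plus
    movement is at most [(4 * D + 5) * S + (4 * D + 4) * KL], while the divergence part of the
    potential pays [(4 * D + 5) * (S + KL - lam s)], with [lam s <= c s]. *)
Lemma potential_decrease p z lam c s :
  is_dist p -> is_dist z ->
  (forall u, (u < N)%nat -> 0 <= lam u) ->
  (forall u, In u nonroot ->
     smoothed z u = smoothed p u * exp ((lam (par u) - lam u) / w u)) ->
  (forall l, In l (leaves N par) -> lam l <= c l /\ z l * (c l - lam l) = 0) ->
  In s (leaves N par) ->
  sumL (leaves N par) (fun l => z l * c l) + movement p z <=
    (4 * D + 5) * c s + potential s p - potential s z.
Proof.
  intros (Hp0 & _ & Hp1) (Hz0 & _ & Hz1) Hlam Hexp Hcompl Hs.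
  set (mu := fun u => lam (par u) - lam u).
  (* The divergence of one edge, with the logarithm already replaced by the price difference [mu u];
     it is nonnegative because [1 + x <= exp x]. *)
  set (kl := fun u => w u * (mass p u - mass z u) + smoothed z u * mu u).
  assert (Hln : forall u, In u nonroot ->
    w u * (ln (smoothed z u) - ln (smoothed p u)) = mu u).
  { intros u Hu. pose proof (w_gt0 u Hu). rewrite (Hexp u Hu).
    rewrite ln_mult, ln_exp; [unfold mu; field; lra| |apply exp_pos].
    apply smoothed_gt0; [exact Hp0|]. apply nonroot_iff in Hu; lia. }
  assert (Hkl : forall u, In u nonroot -> 0 <= kl u).
  { intros u Hu. pose proof (w_gt0 u Hu) as Hw. pose proof (Hexp u Hu) as E.
    assert (Hb : 0 < smoothed p u) by (apply smoothed_gt0; [exact Hp0|]; apply nonroot_iff in Hu; lia).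
    assert (Ha : 0 < smoothed z u) by (apply smoothed_gt0; [exact Hz0|]; apply nonroot_iff in Hu; lia).
    assert (E' : smoothed p u = smoothed z u * exp (- (mu u / w u))).
    { rewrite E, Rmult_assoc. fold (mu u). rewrite <- exp_plus, Rplus_opp_r, exp_0. ring. }
    assert (H1 : smoothed z u * (1 - mu u / w u) <= smoothed p u).
    { rewrite E'. apply Rmult_le_compat_l; [lra|]. pose proof (exp_ineq1_le (- (mu u / w u))). lra. }
    apply (Rmult_le_compat_l (w u)) in H1; [|lra].
    replace (w u * (smoothed z u * (1 - mu u / w u)))
      with (w u * smoothed z u - smoothed z u * mu u) in H1 by (field; lra).
    unfold kl. unfold smoothed in *. lra. }
  set (A := sumL nonroot (fun u => smoothed z u * lam u)).
  set (KL := sumL nonroot kl).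
  set (dPsi := sumL nonroot (fun u => w u * (mass z u - mass p u))).
  set (dPsi' := sumL nonroot (fun u => depth u * (w u * (mass z u - mass p u)))).
  set (S := sumL (leaves N par) (fun l => z l * lam l)).
  set (Sd := sumL (leaves N par) (fun l => delta l * lam l)).
  assert (Hservice : sumL (leaves N par) (fun l => z l * c l) = S).
  { apply sumL_ext. intros l Hl. destruct (Hcompl l Hl). lra. }
  assert (HKL0 : 0 <= KL) by now apply sumL_ge0.
  assert (HSa : sumL (leaves N par) (fun l => smoothed z l * lam l) = S + Sd).
  { unfold S, Sd. rewrite <- sumL_plus. apply sumL_ext. intros l Hl. unfold smoothed.
    rewrite mass_leaf by exact Hl. ring. }
  assert (Hsum : sumL nonroot (fun u => smoothed z u * mu u) = KL + dPsi).
  { unfold KL, dPsi. rewrite <- sumL_plus. apply sumL_ext. intros u _. unfold kl. ring. }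
  (* The factor 2 is the smoothed mass of the root: one from [z] and one from [delta]. *)
  assert (H1 : KL + dPsi = 2 * lam 0%nat - (S + Sd)).
  { rewrite <- Hsum, <- HSa. unfold mu.
    rewrite (sum_difference (smoothed z) lam (smoothed_additive z)).
    unfold smoothed at 1. rewrite mass_root, Hz1, delta_root. ring. }
  assert (H2 : sumL nonroot (fun u => delta u * mu u) = lam 0%nat - Sd).
  { unfold mu. rewrite (sum_difference delta lam (mass_additive _)), delta_root.
    unfold Sd. ring. }
  (* The two masses agree at the root, so no root price appears. *)
  assert (H3 : sumL nonroot (fun u => (mass z u - ind (anc N par u s)) * mu u) = lam s - S).
  { rewrite (sumL_ext _ _ (fun u => (mass z u - mass (point s) u) * mu u))
      by (intros; now rewrite mass_point).
    unfold mu. rewrite (sum_difference (fun u => mass z u - mass (point s) u) lam)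
      by (apply additive_minus; apply mass_additive).
    rewrite !mass_root, Hz1, (proj2 (proj2 (point_dist s Hs))).
    rewrite <- (sumL_point s lam Hs). unfold S.
    rewrite (sumL_ext _ (fun l => (mass z l - mass (point s) l) * lam l)
      (fun l => z l * lam l - point s l * lam l)) by (intros; now rewrite !mass_leaf, Rmult_minus_distr_r).
    rewrite sumL_minus. ring. }
  (* Depths are replaced by [D] only on the nonnegative [kl] and leaf terms; the signed terms keep
     their exact depth and telescope as [dPsi']. The root term is dropped by sign. *)
  assert (H4 : A <= D * KL + dPsi' + (D + 1) * (S + Sd)).
  { unfold A. rewrite (sum_depth_difference (smoothed z) lam (smoothed_additive z)).
    assert (Hdep : sumL nonroot (fun u => depth u * (smoothed z u * (lam (par u) - lam u)))
      <= D * KL + dPsi').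
    { unfold KL, dPsi'. rewrite <- sumL_scal, <- sumL_plus. apply sumL_le. intros u Hu.
      replace (smoothed z u * (lam (par u) - lam u))
        with (kl u + w u * (mass z u - mass p u)) by (unfold kl, mu; ring).
      rewrite Rmult_plus_distr_l. apply Rplus_le_compat_r.
      apply Rmult_le_compat_r; [now apply Hkl|]. apply depth_le. apply nonroot_iff in Hu. lia. }
    assert (Hlf : sumL (leaves N par) (fun l => (1 + depth l) * (smoothed z l * lam l))
      <= (D + 1) * (S + Sd)).
    { rewrite <- HSa, <- sumL_scal. apply sumL_le. intros l Hl%leaf_lt.
      pose proof (depth_le l Hl). fold D in H. pose proof (smoothed_gt0 z l Hz0 Hl).
      apply Rmult_le_compat_r; [apply Rmult_le_pos; [lra|now apply Hlam]|lra]. }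
    pose proof (smoothed_gt0 z 0%nat Hz0 N_gt0).
    pose proof (Rmult_le_pos (smoothed z 0%nat) (lam 0%nat) ltac:(lra) (Hlam 0%nat N_gt0)).
    lra. }
  (* The absolute change is the net change plus twice the decrease, and a weighted decrease is at
     most [smoothed z u * lam u + kl u] because the parent's price is nonnegative. *)
  assert (H5 : movement p z <= 2 * A + 2 * KL + dPsi).
  { unfold movement, A, KL, dPsi. rewrite <- !sumL_scal, <- !sumL_plus. apply sumL_le.
    intros u Hu. pose proof (w_gt0 u Hu) as Hw. specialize (Hkl u Hu).
    apply nonroot_iff in Hu. pose proof (par_lt u Hu).
    pose proof (smoothed_gt0 z u Hz0 ltac:(lia)) as Ha.
    pose proof (Rmult_le_pos (smoothed z u) (lam u) ltac:(lra) (Hlam u ltac:(lia))).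
    pose proof (Rmult_le_pos (smoothed z u) (lam (par u)) ltac:(lra) (Hlam (par u) ltac:(lia))).
    destruct (Rle_dec (mass z u) (mass p u)).
    - rewrite Rabs_pos_eq by lra. unfold kl, mu. lra.
    - rewrite Rabs_left1 by lra. lra. }
  assert (H6 : potential s p - potential s z =
    (4 * D + 5) * (KL + S - lam s) + 2 * (D + 1) * dPsi
    - 4 * (D + 1) * (lam 0%nat - Sd) + 2 * dPsi' + dPsi).
  { unfold potential. rewrite <- sumL_minus.
    rewrite (sumL_ext _ _ (fun u =>
      (4 * D + 5) * (smoothed z u * mu u)
      - (4 * D + 5) * ((mass z u - ind (anc N par u s)) * mu u)
      - 4 * (D + 1) * (delta u * mu u)
      + 2 * (depth u * (w u * (mass z u - mass p u)))
      + (2 * (D + 1) + 1 - (4 * D + 5)) * (w u * (mass z u - mass p u)))).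
    2:{ intros u Hu. rewrite <- (Hln u Hu).
        set (lz := ln (smoothed z u)). set (lp := ln (smoothed p u)). unfold smoothed. ring. }
    rewrite !sumL_plus, !sumL_minus, !sumL_scal, Hsum, H2, H3.
    fold dPsi' dPsi. lra. }
  destruct (Hcompl s Hs) as [Hcs _]. pose proof D_ge0 as HD.
  apply (Rmult_le_compat_l (4 * D + 5)) in Hcs; [|lra].
  assert (0 <= D * KL) by now apply Rmult_le_pos.
  replace (lam 0%nat) with ((KL + dPsi + S + Sd) / 2) in H6 by lra.
  lra.
Qed.

(** A smoothed mass is at least one leaf's share [/ nleaves] and at most 2, hence at most
    [nleaves]. *)
Lemma ln_smoothed_bound p u :
  (2 <= length (leaves N par))%nat -> is_dist p -> (u < N)%nat ->
  - ln nleaves <= ln (smoothed p u) <= ln nleaves.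
Proof.
  intros Hn (Hp0 & _ & Hp1) Hu.
  assert (H2 : 2 <= nleaves) by (apply (le_INR 2), Hn).
  pose proof (mass_ge0 p u Hp0). pose proof (mass_le_total p u Hp0) as Hm.
  rewrite Hp1 in Hm. pose proof (delta_ge u Hu).
  assert (Hd : delta u <= 1).
  { rewrite <- delta_root. unfold delta at 2. rewrite mass_root.
    apply mass_le_total. intros _. left. apply Rinv_0_lt_compat. lra. }
  pose proof (Rinv_0_lt_compat nleaves ltac:(lra)).
  unfold smoothed. split.
  - rewrite <- ln_Rinv by lra. apply ln_le; lra.
  - apply ln_le; lra.
Qed.

(** Only the edges separating [s] from [s'] change, each by its length times [4 * D + 5] times a
    logarithm. *)
Lemma potential_lipschitz p s s' :
  (2 <= length (leaves N par))%nat -> is_dist p ->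
  potential s' p <= potential s p + (4 * D + 5) * ln nleaves * tdist N par w s s'.
Proof.
  intros Hn Hp. rewrite tdist_sum. unfold potential. rewrite <- sumL_scal, <- sumL_plus.
  apply sumL_le. intros u Hu. pose proof (w_gt0 u Hu) as Hw.
  assert (Hln : - ln nleaves <= ln (smoothed p u) <= ln nleaves)
    by (apply ln_smoothed_bound; auto; apply nonroot_iff in Hu; lia).
  destruct Hln as [Hl1 Hl2]. pose proof D_ge0 as HD.
  pose proof (Rmult_le_pos (w u) (4 * D + 5) ltac:(lra) ltac:(lra)) as Hk.
  apply (Rmult_le_compat_l _ _ _ Hk) in Hl1. apply (Rmult_le_compat_l _ _ _ Hk) in Hl2.
  destruct (anc N par u s), (anc N par u s'); cbn [xorb ind]; lra.
Qed.

Lemma potential_bounded_below :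
  (2 <= length (leaves N par))%nat ->
  exists B, forall p s, is_dist p -> - B <= potential s p.
Proof.
  intros Hn. set (L := ln nleaves).
  exists (sumL nonroot (fun u => w u *
    ((4 * D + 5) * (2 * L) + (2 * (D + 1) * (1 + 2 * L) + 2 * D + 1)))).
  intros p s Hp. unfold potential.
  enough (H : 0 <= potential s p + sumL nonroot (fun u => w u *
    ((4 * D + 5) * (2 * L) + (2 * (D + 1) * (1 + 2 * L) + 2 * D + 1))))
    by (unfold potential in H; lra).
  unfold potential. rewrite <- sumL_plus. apply sumL_ge0. intros u Hu.
  pose proof (w_gt0 u Hu) as Hw. apply nonroot_iff in Hu.
  pose proof (ln_smoothed_bound p u Hn Hp ltac:(lia)) as Hln. fold L in Hln.
  destruct Hln as [Hl1 Hl2]. destruct Hp as (Hp0 & _ & Hp1).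
  pose proof (mass_ge0 p u Hp0) as Hm0. pose proof (mass_le_total p u Hp0) as Hm1.
  rewrite Hp1 in Hm1.
  assert (Hd : 0 < delta u) by (apply delta_gt0; lia).
  assert (Hd1 : delta u <= 1).
  { rewrite <- delta_root. unfold delta at 2. rewrite mass_root.
    apply mass_le_total. intros _. left. apply Rinv_0_lt_compat, nleaves_gt0. }
  pose proof D_ge0 as HD. pose proof (depth_ge0 u). pose proof (depth_le u ltac:(lia)) as Hdep.
  fold D in Hdep. rewrite <- Rmult_plus_distr_l. apply Rmult_le_pos; [lra|].
  set (l := ln (smoothed p u)) in *. set (m := mass p u) in *.
  assert (Hdl : - L <= delta u * l <= L) by nra.
  assert (Hyl : ind (anc N par u s) * l <= L) by (destruct (anc N par u s); cbn; lra).
  assert (H1 : 0 <= (4 * D + 5) * (m - (ind (anc N par u s) + delta u) * l + 2 * L))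
    by (apply Rmult_le_pos; lra).
  assert (H2 : 0 <= (2 * (D + 1)) * (1 + 2 * L - (m - 2 * delta u * l)))
    by (apply Rmult_le_pos; lra).
  assert (H3 : depth u * m <= D) by nra.
  lra.
Qed.

(** * The randomized algorithm *)

(** Stated for all pairs so that [choice] yields a function. With a negative cost the distribution
    is kept, since a valid algorithm must answer every input. *)
Lemma step_exists (pc : (nat -> R) * (nat -> R)) :
  (1 < N)%nat ->
  exists z, is_dist (fst pc) ->
    is_dist z /\
    ((forall l, In l (leaves N par) -> 0 <= snd pc l) ->
     forall s, In s (leaves N par) ->
       sumL (leaves N par) (fun l => z l * snd pc l) + movement (fst pc) z <=
       (4 * D + 5) * snd pc s + potential s (fst pc) - potential s z).
Proof.
  intros HN. destruct pc as [p c]. cbn [fst snd].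
  destruct (classic (is_dist p)) as [Hp|Hp]; [|now exists p].
  destruct (classic (forall l, In l (leaves N par) -> 0 <= c l)) as [Hc|Hc];
    [|now exists p].
  destruct (mirror_step p c HN Hp Hc) as (z & lam & Hz & Hlam & Hexp & Hcompl).
  exists z. intros _. split; [exact Hz|]. intros _ s Hs.
  now apply (potential_decrease p z lam c s).
Qed.

Lemma kernel_exists (pz : (nat -> R) * (nat -> R)) :
  exists T, is_dist (fst pz) -> is_dist (snd pz) ->
    transports (fst pz) (snd pz) T (movement (fst pz) (snd pz)).
Proof.
  destruct pz as [p z]. cbn [fst snd].
  destruct (classic (is_dist p /\ is_dist z)) as [[Hp Hz]|H].
  - destruct (transport_exists p z Hp Hz) as (T & HT). now exists T.
  - exists (fun _ _ => 0). tauto.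
Qed.

Section Algorithm.

Variable start : nat -> nat.
Variable step : (nat -> R) * (nat -> R) -> nat -> R.
Variable kernel : (nat -> R) * (nat -> R) -> nat -> nat -> R.

Definition state (r : nat) (past : list (nat -> R)) : nat -> R :=
  fold_left (fun p c => step (p, c)) past (point (start r)).

(** The head of [hs] is the initial state and its last entry the current one; [removelast cs] are
    the costs before the present one. The kernel couples the two consecutive deterministic
    distributions. *)
Definition algorithm : online_alg := fun cs hs =>
  kernel (state (hd 0%nat hs) (removelast cs), state (hd 0%nat hs) cs) (last hs 0%nat).

Lemma hd_app (hs : list nat) x : hs <> [] -> hd 0%nat (hs ++ [x]) = hd 0%nat hs.
Proof. destruct hs; [contradiction|reflexivity]. Qed.

(** The algorithm reads only the ends of the history, so any history can be shortened to
    [[r; x]]. *)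
Lemma exp_cost_history X d cs past hs hs' prev :
  hs <> [] -> hs' <> [] ->
  hd 0%nat hs = hd 0%nat hs' -> last hs 0%nat = last hs' 0%nat ->
  exp_cost X d algorithm past hs prev cs = exp_cost X d algorithm past hs' prev cs.
Proof.
  revert past hs hs' prev. induction cs as [|c cs IH]; intros past hs hs' prev H1 H2 H3 H4;
    [reflexivity|].
  cbn [exp_cost]. apply sumL_ext. intros x _.
  unfold algorithm at 1 3. rewrite H3, H4. f_equal. f_equal. apply IH.
  - intros E%app_eq_nil. now destruct E.
  - intros E%app_eq_nil. now destruct E.
  - now rewrite !hd_app.
  - now rewrite !last_last.
Qed.

Hypothesis Hstart : forall s, In (start s) (leaves N par) /\ (In s (leaves N par) -> start s = s).
Hypothesis Hstep : forall pc, is_dist (fst pc) ->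
  is_dist (step pc) /\
  ((forall l, In l (leaves N par) -> 0 <= snd pc l) ->
   forall s, In s (leaves N par) ->
     sumL (leaves N par) (fun l => step pc l * snd pc l) + movement (fst pc) (step pc) <=
     (4 * D + 5) * snd pc s + potential s (fst pc) - potential s (step pc)).
Hypothesis Hkernel : forall pz, is_dist (fst pz) -> is_dist (snd pz) ->
  transports (fst pz) (snd pz) (kernel pz) (movement (fst pz) (snd pz)).

Lemma state_snoc r past c : state r (past ++ [c]) = step (state r past, c).
Proof. unfold state. now rewrite fold_left_app. Qed.

Lemma state_dist r past : is_dist (state r past).
Proof.
  induction past as [|c past IH] using rev_ind.
  - apply point_dist, Hstart.
  - rewrite state_snoc. now apply Hstep.
Qed.

Lemma algorithm_valid : valid_alg (leaves N par) algorithm.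
Proof. intros cs hs. apply Hkernel; apply state_dist. Qed.

(** The current state has law [state r past] while the offline state is [s]. In each round the
    offline player first moves, paid by the Lipschitz bound, and then both serve the cost, paid by
    the potential decrease at the new offline state. *)
Lemma algorithm_potential_bound alpha B r cs :
  (2 <= length (leaves N par))%nat ->
  4 * D + 5 <= alpha -> (4 * D + 5) * ln nleaves <= alpha ->
  (forall p s, is_dist p -> - B <= potential s p) ->
  forall past s sigma,
  (forall c x, In c cs -> In x (leaves N par) -> 0 <= c x) ->
  In s (leaves N par) -> length sigma = length cs ->
  (forall x, In x sigma -> In x (leaves N par)) ->
  sumL (leaves N par) (fun x => state r past x *
    exp_cost (leaves N par) (tdist N par w) algorithm past [r; x] x cs) <=
  alpha * det_cost (tdist N par w) s cs sigma + potential s (state r past) + B.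
Proof.
  intros Hn Ha1 Ha2 HB. induction cs as [|c cs IH]; intros past s sigma Hcs Hs Hlen Hsig.
  - cbn [exp_cost det_cost]. rewrite (sumL_ext _ _ (fun _ => 0)) by (intros; ring).
    rewrite sumL_0. specialize (HB (state r past) s (state_dist r past)). lra.
  - destruct sigma as [|s' sigma]; [discriminate|]. cbn [exp_cost det_cost].
    assert (Hs' : In s' (leaves N par)) by auto with datatypes.
    assert (Hc : forall l, In l (leaves N par) -> 0 <= c l) by (intros; apply Hcs; auto with datatypes).
    specialize (IH (past ++ [c]) s' sigma ltac:(intros; apply Hcs; auto with datatypes)
      Hs' ltac:(now injection Hlen) ltac:(auto with datatypes)).
    pose proof (state_dist r past) as Hp. pose proof (state_dist r (past ++ [c])) as Hz.
    destruct (Hstep (state r past, c) Hp) as [_ Hcost]. specialize (Hcost Hc s' Hs').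
    rewrite <- state_snoc in Hcost. cbn [fst snd] in Hcost.
    destruct (Hkernel (state r past, state r (past ++ [c])) Hp Hz) as (_ & Hmarg & Hmove).
    cbn [fst snd] in Hmarg, Hmove.
    set (T := kernel (state r past, state r (past ++ [c]))) in *.
    set (G := fun x => exp_cost (leaves N par) (tdist N par w) algorithm (past ++ [c]) [r; x] x cs).
    change (sumL (leaves N par) (fun x => state r (past ++ [c]) x * G x) <=
      alpha * det_cost (tdist N par w) s' cs sigma + potential s' (state r (past ++ [c])) + B) in IH.
    (* Splits the expected cost into service, movement and future; the marginal of [T] makes the
       next state distributed as [state r (past ++ [c])]. *)
    assert (Hexp : sumL (leaves N par) (fun y => state r past y * sumL (leaves N par) (fun x =>
        algorithm (past ++ [c]) [r; y] x * (c x + tdist N par w y x +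
          exp_cost (leaves N par) (tdist N par w) algorithm (past ++ [c]) ([r; y] ++ [x]) x cs))) =
      sumL (leaves N par) (fun x => state r (past ++ [c]) x * c x)
      + sumL (leaves N par) (fun y => state r past y * sumL (leaves N par) (fun x =>
          T y x * tdist N par w y x))
      + sumL (leaves N par) (fun x => state r (past ++ [c]) x * G x)).
    { rewrite (sumL_ext _ _ (fun y =>
        sumL (leaves N par) (fun x => state r past y * T y x * (c x + G x))
        + state r past y * sumL (leaves N par) (fun x => T y x * tdist N par w y x))).
      2:{ intros y _. rewrite <- !sumL_scal, <- sumL_plus. apply sumL_ext. intros x _.
          unfold algorithm at 1. cbn [hd last]. rewrite removelast_last. fold T.
          rewrite (exp_cost_history _ _ cs (past ++ [c]) ([r; y] ++ [x]) [r; x])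
            by (discriminate || reflexivity).
          fold (G x). ring. }
      rewrite sumL_plus, sumL_swap.
      rewrite (sumL_ext _ (fun x => sumL (leaves N par) (fun y => state r past y * T y x * (c x + G x)))
        (fun x => state r (past ++ [c]) x * c x + state r (past ++ [c]) x * G x)).
      2:{ intros x Hx. rewrite sumL_scalr, (Hmarg x Hx). ring. }
      rewrite sumL_plus. ring. }
    rewrite Hexp.
    pose proof (potential_lipschitz (state r past) s s' Hn Hp) as Hlip.
    pose proof (tdist_ge0 s s') as Hd.
    pose proof (Rmult_le_compat_r _ _ _ Hd Ha2).
    pose proof (Rmult_le_compat_r _ _ _ (Hc s' Hs') Ha1).
    lra.
Qed.

Lemma algorithm_competitive alpha :
  (2 <= length (leaves N par))%nat ->
  4 * D + 5 <= alpha -> (4 * D + 5) * ln nleaves <= alpha ->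
  competitive (leaves N par) (tdist N par w) algorithm alpha.
Proof.
  intros Hn Ha1 Ha2 r Hr. destruct (potential_bounded_below Hn) as (B & HB).
  exists (potential r (point r) + B). intros cs Hcs sigma Hlen Hsig.
  pose proof (algorithm_potential_bound alpha B r cs Hn Ha1 Ha2 HB [] r sigma Hcs Hr Hlen Hsig) as H.
  unfold state in H. cbn [fold_left] in H. rewrite (proj2 (Hstart r) Hr) in H.
  rewrite sumL_point in H by exact Hr. unfold alg_cost.
  (* The doubled [r] brings the initial history into the form [[r; x]] of the invariant. *)
  rewrite (exp_cost_history _ _ cs [] [r] [r; r]) by (discriminate || reflexivity). lra.
Qed.

End Algorithm.

Lemma N_gt1 : (2 <= length (leaves N par))%nat -> (1 < N)%nat.
Proof.
  intros H. pose proof (filter_length_le (is_leaf N par) (seq 0 N)) as Hle.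
  rewrite length_seq in Hle. unfold leaves in H. lia.
Qed.

Lemma D_ge1 : (1 < N)%nat -> 1 <= D.
Proof.
  intros HN. apply (Rle_trans _ (depth 1)); [|now apply depth_le].
  rewrite depth_par by (apply nonroot_iff; lia). pose proof (depth_ge0 (par 1)). lra.
Qed.

End Tree.

Theorem theorem1 :
  exists K : R, 0 < K /\
  forall (N : nat) (par : nat -> nat) (w : nat -> R),
    is_tree N par w ->
    (2 <= length (leaves N par))%nat ->
    exists A : online_alg,
      valid_alg (leaves N par) A /\
      competitive (leaves N par) (tdist N par w) A
        (K * INR (comb_depth N par) * ln (INR (length (leaves N par)))).
Proof.
  (* Since [D >= 1], [4 * D + 5 <= 9 * D]; since the logarithm is at least [/ 2], doubling 9 also
     covers the bound without the logarithm. *)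
  exists 18. split; [lra|]. intros N par w Htree Hn.
  pose proof (N_gt1 N par Hn) as HN.
  destruct (choice _ (leaf_default N par w Htree)) as (start & Hstart).
  destruct (choice _ (fun pc => step_exists N par w Htree pc HN)) as (step & Hstep).
  destruct (choice _ (kernel_exists N par w Htree)) as (kernel & Hkernel).
  exists (algorithm start step kernel). split.
  - now apply (algorithm_valid N par w).
  - assert (HD : 1 <= INR (comb_depth N par)) by exact (D_ge1 N par w Htree HN).
    assert (Hln : / 2 <= ln (INR (length (leaves N par)))).
    { pose proof ln_lt_2. pose proof (ln_le 2 (INR (length (leaves N par)))
        ltac:(lra) (le_INR 2 _ Hn)). lra. }
    apply (algorithm_competitive N par w Htree); auto; unfold D, nleaves.
    + nra.
    + apply Rmult_le_compat_r; lra.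
Qed.
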